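(* Let $\mathcal{K}=\mathbb{R}^m$. Let $f\in\Gamma_0(\mathcal{X})$, $g=\bigoplus_{i=1}^m g_i\in\Gamma_0(\mathbb{R}^m)$ and $A:\mathcal{X}\to\mathbb{R}^m:x\mapsto(A_1x,\ldots,A_mx)$ with $A_i\in\mathcal{B}(\mathcal{X},\mathbb{R})\setminus\{0\}$ $(i=1,\ldots,m)$ satisfy $\mathcal{S}_p:=\operatorname{argmin}_{x\in\mathcal{X}}[f(x)+g(Ax)]\neq\varnothing$ and the qualification condition $0\in\operatorname{sri}(\operatorname{dom}(g)-A\operatorname{dom}(f))$. Suppose that $\Psi\in\Gamma_0(\mathcal{X})$ is Gâteaux differentiable with Lipschitzian gradient $\nabla\Psi$ over $\mathcal{X}$ and that $\Omega:=\operatorname{argmin}_{x^\star\in\mathcal{S}_p}\Psi(x^\star)\neq\varnothing$. Define $\mathbf{T}_{\rm DRS_{II}}:\mathcal{X}^{m+1}\to\mathcal{X}^{m+1}:(x^{(1)},\ldots,x^{(m+1)})\mapsto(x_T^{(1)},\ldots,x_T^{(m+1)})$ by $$\begin{aligned}\bar{x}&=\tfrac{1}{m+1}\textstyle\sum_{j=1}^{m+1}x^{(j)},\\ x_T^{(i)}&=(2\bar{x}-x^{(i)})+2(A_iA_i^* )^{-1}A_i^*\bigl(\operatorname{prox}_{(A_iA_i^* )g_i}[A_i(2\bar{x}-x^{(i)})]-A_i(2\bar{x}-x^{(i)})\bigr)\quad(i=1,\ldots,m),\\ x_T^{(m+1)}&=2\operatorname{prox}_f(2\bar{x}-x^{(m+1)})-(2\bar{x}-x^{(m+1)}).\end{aligned}$$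 Then $\mathbf{T}_{\rm DRS_{II}}$ can be plugged into the hybrid steepest descent method, with any $\alpha\in(0,1)$ and any $(\lambda_{n+1})_{n\in\mathbb{N}}\in\ell_+^2\setminus\ell_+^1$, as $$\begin{aligned}(x_{n+1/2}^{(1)},\ldots,x_{n+1/2}^{(m+1)})&=(1-\alpha)(x_n^{(1)},\ldots,x_n^{(m+1)})+\alpha\mathbf{T}_{\rm DRS_{II}}(x_n^{(1)},\ldots,x_n^{(m+1)}),\\ x_{n+1}^\star&=\tfrac{1}{m+1}\textstyle\sum_{j=1}^{m+1}x_{n+1/2}^{(j)},\\ x_{n+1}^{(i)}&=x_{n+1/2}^{(i)}-\tfrac{\lambda_{n+1}}{m+1}\nabla\Psi(x_{n+1}^\star)\quad(i=1,\ldots,m+1),\end{aligned}$$ and, for any $(x_0^{(1)},\ldots,x_0^{(m+1)})\in\mathcal{X}^{m+1}$, this algorithm generates a sequence $(x_{n+1}^\star)_{n\in\mathbb{N}}\subset\mathcal{X}$ which satisfies $\lim_{n\to\infty}d_\Omega(x_n^\star)=0$ if $\dim(\mathcal{X})<\infty$ and $\operatorname{Fix}(\mathbf{T}_{\rm DRS_{II}})$ is bounded.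
   Context: $\mathcal{X}$ is a real Hilbert space; $\mathcal{X}^{m+1}$ is the product Hilbert space with inner product the sum of the componentwise inner products. $\mathcal{B}(\mathcal{X},\mathbb{R})$ is the set of bounded linear operators $\mathcal{X}\to\mathbb{R}$, $A_i^*:\mathbb{R}\to\mathcal{X}$ is the adjoint of $A_i$, so $A_iA_i^*$ is identified with a positive real number. $\Gamma_0(\mathcal{X})$ is the set of proper lower semicontinuous convex functions $\mathcal{X}\to(-\infty,\infty]$; $\operatorname{dom}(f)=\{x: f(x)<\infty\}$. $\bigoplus_{i=1}^m g_i:(t_1,\ldots,t_m)\mapsto\sum_{i=1}^m g_i(t_i)$ with $g_i\in\Gamma_0(\mathbb{R})$. For a convex set $C$, $\operatorname{sri}(C)=\{x\in C:\operatorname{cone}(C-x)=\overline{\operatorname{span}}(C-x)\}$ where $\operatorname{cone}(S)=\{\lambda s:\lambda>0,s\in S\}$. $\operatorname{prox}_f(x)=\operatorname{argmin}_{y}\, f(y)+\frac12\|x-y\|^2$. $\operatorname{Fix}(T)=\{z: T(z)=z\}$. $d_\Omega(x)=\min_{y\in\Omega}\|x-y\|$. $\ell_+^1$ (resp. $\ell_+^2$) is the set of summable (resp. square-summable) nonnegative real sequences. The hybrid steepest descent method for minimizing a Gâteaux differentiable convex function $\Theta$ over $\operatorname{Fix}(T)$, with $T$ nonexpansive (i.e. $1$-Lipschitz), is the iteration $z_{n+1}=T(z_n)-\lambda_{n+1}\nabla\Theta(T(z_n))$; the displayed algorithm is this iteration on $\mathcal{X}^{m+1}$ for the operator $(1-\alpha)\mathrm{I}+\alpha\mathbf{T}_{\rm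 DRS_{II}}$ and $\Theta=\Psi\circ\Xi$, where $\Xi(x^{(1)},\ldots,x^{(m+1)})=\frac{1}{m+1}\sum_{j=1}^{m+1}x^{(j)}$ and $\mathrm{I}$ is the identity. *)

(* Defs.v *)
From HB Require Import structures.
From mathcomp Require Import all_boot all_order all_algebra.
From mathcomp Require Import all_classical all_reals all_analysis.
From mathcomp Require Import ring lra.
Set Implicit Arguments.
Unset Strict Implicit.
Unset Printing Implicit Defensive.

Import Order.TTheory GRing.Theory Num.Theory.
Import numFieldNormedType.Exports.

Local Open Scope classical_set_scope.
Local Open Scope ring_scope.

(* Real Hilbert spaces: complete normed modules whose norm comes from an inner
   product, i.e. from a positive definite symmetric bilinear form. *)
HB.mixin Record CompleteNormedModule_isHilbert (R : realType) X
    & CompleteNormedModule R X := {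
  inner : {dot X for (@idfun R)} ;
  inner_norm : forall x : X, inner x x = `|x| ^+ 2
}.

#[short(type="hilbertType")]
HB.structure Definition Hilbert (R : realType) :=
  {X of CompleteNormedModule R X & CompleteNormedModule_isHilbert R X}.

Arguments inner {R s}.

(* The product Hilbert space X^n. *)
Definition hprod (R : realType) (n : nat) (X : hilbertType R) : Type :=
  {ffun 'I_n -> X}.

Section HilbertProduct.
Context (R : realType) (n : nat) (X : hilbertType R).
Local Notation H := (hprod n X).
Implicit Types x y z : H.

HB.instance Definition _ := GRing.Lmodule.on H.

Definition hprod_inner x y : R := \sum_(i < n) inner (x i) (y i).

Lemma innerC (u v : X) : inner u v = inner v u.
Proof. by rewrite hermC expr0 mul1r. Qed.

Let hprod_innerC x y : hprod_inner x y = hprod_inner y x.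
Proof. by apply: eq_bigr => i _; rewrite innerC. Qed.

Let hprod_innerDZ y a x z :
  hprod_inner (a *: x + z) y = a * hprod_inner x y + hprod_inner z y.
Proof.
rewrite /hprod_inner mulr_sumr -big_split /=.
by apply: eq_bigr => i _; rewrite !ffunE linearPl.
Qed.

Let hprod_inner_bilinear : bilinear_for
  (GRing.Scale.Law.clone _ _ *%R _)
  (GRing.Scale.Law.clone _ _ ((@idfun R) \; *%R) _) hprod_inner.
Proof.
split=> [y|y] a x z /=; first exact: hprod_innerDZ.
by rewrite hprod_innerC hprod_innerDZ !(hprod_innerC y).
Qed.

HB.instance Definition _ :=
  bilinear_isBilinear.Build R H H R _ _ hprod_inner hprod_inner_bilinear.

Let hprod_inner_herm x y :
  hprod_inner x y = (-1) ^+ false * idfun (hprod_inner y x).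
Proof. by rewrite expr0 mul1r hprod_innerC. Qed.

HB.instance Definition _ :=
  isHermitianSesquilinear.Build R H false idfun hprod_inner hprod_inner_herm.

Let hprod_inner_ge0 x : 0 <= hprod_inner x x.
Proof. by apply: sumr_ge0 => i _; rewrite inner_norm sqr_ge0. Qed.

Let hprod_inner_gt0 x : x != 0 -> 0 < hprod_inner x x.
Proof.
move=> x0; rewrite lt_def hprod_inner_ge0 andbT; apply: contra x0 => /eqP.
move/psumr_eq0P => x0; apply/eqP/ffunP => i; rewrite !ffunE; apply/eqP.
rewrite -normr_eq0 -sqrf_eq0 -inner_norm x0// => j _.
by rewrite inner_norm sqr_ge0.
Qed.

HB.instance Definition _ :=
  isDotProduct.Build R H hprod_inner hprod_inner_gt0.

Definition hprod_norm x : R := Num.sqrt (hprod_inner x x).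

Let hprod_norm_sqr x : hprod_norm x ^+ 2 = hprod_inner x x.
Proof. exact: sqr_sqrtr. Qed.

Let hprod_CS x y : hprod_inner x y <= hprod_norm x * hprod_norm y.
Proof.
have [->|y0] := eqVneq y 0; first by rewrite linear0r mulr_ge0// sqrtr_ge0.
have c0 := hprod_inner_gt0 y0.
have := hprod_inner_ge0 (hprod_inner y y *: x - hprod_inner x y *: y).
rewrite !(linearBl, linearBr) !linearZl_LR !linearZr_LR /= (hprod_innerC y x).
set a := hprod_inner x x; set b := hprod_inner x y; set c := hprod_inner y y.
rewrite [leRHS](_ : _ = c * (a * c - b ^+ 2)); last by ring.
rewrite pmulr_rge0// subr_ge0 => bac.
rewrite (le_trans (ler_norm _))// -sqrtr_sqr -sqrtrM ?hprod_inner_ge0//.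
exact: ler_wsqrtr.
Qed.

Let ler_hprod_normD x y :
  hprod_norm (x + y) <= hprod_norm x + hprod_norm y.
Proof.
rewrite -(@ler_pXn2r _ 2) ?nnegrE ?addr_ge0 ?sqrtr_ge0// sqrrD.
rewrite !hprod_norm_sqr !(linearDl, linearDr)/= (hprod_innerC y x).
by have := hprod_CS x y; lra.
Qed.

Let hprod_normZ (a : R) x : hprod_norm (a *: x) = `|a| * hprod_norm x.
Proof.
rewrite /hprod_norm linearZl_LR linearZr_LR/= mulrA -expr2.
by rewrite sqrtrM ?sqr_ge0// sqrtr_sqr.
Qed.

Let hprod_norm_eq0 x : hprod_norm x = 0 -> x = 0.
Proof.
move=> x0; apply/eqP/negPn/negP => /hprod_inner_gt0.
by rewrite -hprod_norm_sqr x0 expr0n ltxx.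
Qed.

HB.instance Definition _ :=
  Lmodule_isNormed.Build R H ler_hprod_normD hprod_normZ hprod_norm_eq0.

Lemma ler_hprod_norm x (i : 'I_n) : `|x i| <= `|x|.
Proof.
rewrite -(@ler_pXn2r _ 2) ?nnegrE ?normr_ge0// [leRHS]hprod_norm_sqr.
rewrite /hprod_inner (bigD1 i)//= inner_norm lerDl.
by apply: sumr_ge0 => j _; rewrite inner_norm sqr_ge0.
Qed.

Let hprod_norm_ler x (e : R) : 0 <= e ->
  (forall i, `|x i| <= e) -> `|x| <= n%:R * e.
Proof.
move=> e0 xe; rewrite -(@ler_pXn2r _ 2) ?nnegrE ?mulr_ge0//.
rewrite [leLHS]hprod_norm_sqr /hprod_inner.
rewrite (@le_trans _ _ (\sum_(i < n) e ^+ 2))//.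
  by apply: ler_sum => i _; rewrite inner_norm lerXn2r ?nnegrE.
rewrite sumr_const card_ord -[leLHS]mulr_natl exprMn ler_wpM2r ?sqr_ge0//.
by rewrite -natrX ler_nat; case: (n) => // k; rewrite -[leqLHS]expn1 leq_pexp2l.
Qed.

Let hprod_complete (F : set_system H) : ProperFilter F -> cauchy F -> cvg F.
Proof.
move=> FF /cauchy_ballP Fc.
have cvF i : (fun x : H => x i) @ F --> lim ((fun x : H => x i) @ F).
  apply: cauchy_cvg; apply/cauchy_ballP => e e0.
  rewrite near_map2.
  apply: filterS (Fc _ e0) => -[x y] /=; rewrite -!ball_normE/=.
  apply: le_lt_trans; have := ler_hprod_norm (x - y) i.
  by rewrite !ffunE.
apply/cvg_ex; exists ([ffun i => lim ((fun x : H => x i) @ F)] : H).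
apply/cvgrPdist_le => e e0; pose d := e / n.+1%:R.
have d0 : 0 < d by rewrite divr_gt0.
have Fd i : F [set x : H | `|lim ((fun x : H => x i) @ F) - x i| <= d].
  by move/cvgrPdist_le : (cvF i); exact.
have Fd' := filter_forall _ Fd.
near=> x.
have xd : forall i, `|lim ((fun x : H => x i) @ F) - x i| <= d.
  by near: x; exact: Fd'.
rewrite (@le_trans _ _ (n%:R * d))//.
  by apply: hprod_norm_ler => [|i]; rewrite ?(ltW d0)// !ffunE.
by rewrite /d mulrCA ger_pMr// ler_pdivrMr// mul1r ler_nat.
Unshelve. all: by end_near. Qed.

HB.instance Definition _ := Uniform_isComplete.Build H hprod_complete.

Let hprod_inner_norm x : hprod_inner x x = `|x| ^+ 2.
Proof. by rewrite -hprod_norm_sqr. Qed.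

HB.instance Definition _ :=
  CompleteNormedModule_isHilbert.Build R H hprod_inner_norm.

Lemma hprod_innerE x y : inner x y = \sum_(i < n) inner (x i) (y i).
Proof. by []. Qed.

End HilbertProduct.

Section ConvexAnalysis.
Context {R : realType}.
Local Open Scope ereal_scope.

Definition dom {T : Type} (f : T -> \bar R) : set T := [set x | f x < +oo].

(* The bounds 0 < t < 1 keep t and 1 - t positive, so that no 0 * +oo occurs. *)
Definition convex_efun {V : lmodType R} (f : V -> \bar R) : Prop :=
  forall (x y : V) (t : R), (0 < t < 1)%R ->
    f (t *: x + (1 - t) *: y)%R <= t%:E * f x + (1 - t)%:E * f y.

Definition proper {T : Type} (f : T -> \bar R) : Prop :=
  (forall x, f x != -oo) /\ dom f !=set0.

Definition Gamma0 (V : normedModType R) : set (V -> \bar R) :=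
  [set f | [/\ proper f, lower_semicontinuous f & convex_efun f]].

Definition argmin {T : Type} (f : T -> \bar R) (C : set T) : set T :=
  [set x | C x /\ forall y, C y -> f x <= f y].

(* The minimizer exists and is unique when f is in Gamma0 of a Hilbert space;
   0 is a junk value. *)
Definition prox {V : normedModType R} (f : V -> \bar R) (x : V) : V :=
  xget 0%R (argmin (fun y => f y + (2^-1 * `|x - y| ^+ 2)%:E) setT).

End ConvexAnalysis.

Arguments Gamma0 {R} V.

Section VectorSpaceNotions.
Context {R : realType}.

Definition cone {V : lmodType R} (S : set V) : set V :=
  [set l *: s | l in [set l : R | 0 < l] & s in S].

Definition linear_span {V : lmodType R} (S : set V) : set V :=
  [set v | exists (n : nat) (c : 'I_n -> R) (s : 'I_n -> V),
     (forall i, S (s i)) /\ v = \sum_(i < n) c i *: s i].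

(* Strong relative interior. *)
Definition sri {V : normedModType R} (C : set V) : set V :=
  [set x | C x /\ let Cx := [set c - x | c in C] in
                  cone Cx = closure (linear_span Cx)].

Definition finite_dimensional (V : lmodType R) : Prop :=
  exists (n : nat) (e : 'I_n -> V), linear_span (range e) = setT.

Definition dist {V : normedModType R} (S : set V) (x : V) : R :=
  inf [set `|x - y| | y in S].

Definition Fix {T : Type} (F : T -> T) : set T := [set z | F z = z].

Definition ell1_plus : set (R^nat) :=
  [set u : R^nat | (forall n, 0 <= u n) /\ cvgn (series u)].

Definition ell2_plus : set (R^nat) :=
  [set u : R^nat | (forall n, 0 <= u n) /\ cvgn (series (fun n => u n ^+ 2))].

End VectorSpaceNotions.

Section Hilbert.
Context {R : realType} {X : hilbertType R}.

(* A^* t is the Riesz representative of x |-> t * A x, the product of R being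
   its inner product; 0 is a junk value, for A not bounded. *)
Definition adjoint (A : X -> R) (t : R) : X :=
  xget 0 [set v | forall x, inner v x = t * A x].

(* The positive real number A A^*. *)
Definition gram (A : X -> R) : R := A (adjoint A 1).

Definition is_gradient (F : X -> R) (x v : X) : Prop :=
  forall h : X, is_derive x h F (inner v h).

Definition gateaux_differentiable (F : X -> R) : Prop :=
  forall x, exists v, is_gradient F x v.

Definition grad (F : X -> R) (x : X) : X := xget 0 (is_gradient F x).

Definition nonexpansive (T : X -> X) : Prop := 1.-lipschitz T.

(* The hybrid steepest descent method minimizes Theta over Fix T by the
   iteration z_{n+1} = hsdm_step T Theta lambda_{n+1} z_n. *)
Definition hsdm_applicable (T : X -> X) (Theta : X -> R) : Prop :=
  [/\ nonexpansive T, convex_efun (EFin \o Theta)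
    & gateaux_differentiable Theta].

Definition hsdm_step (T : X -> X) (Theta : X -> R) (lam : R) (z : X) : X :=
  T z - lam *: grad Theta (T z).

Definition average (k : nat) (x : hprod k X) : X :=
  k%:R^-1 *: \sum_(j < k) x j.

Definition vec_of_forms (m : nat) (A : 'I_m -> X -> R) (x : X) : 'rV[R]_m :=
  \row_(i < m) A i x.

(* The first m components have indices lift ord_max j with j : 'I_m, and the
   last one has index ord_max. *)
Definition T_DRSII (m : nat) (f : X -> \bar R) (g : 'I_m -> R -> \bar R)
    (A : 'I_m -> X -> R) (x : hprod m.+1 X) : hprod m.+1 X :=
  [ffun i => let y := 2 *: average x - x i in
    if unlift ord_max i is Some j then
      y + (2 * (gram (A j))^-1) *:
        adjoint (A j) (prox (fun t => (gram (A j))%:E * g j t)%E (A j y) - A j y)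
    else 2 *: prox f y - y].

End Hilbert.

Definition oplus {R : realType} (m : nat) (g : 'I_m -> R -> \bar R)
  (t : 'rV[R]_m) : \bar R := (\sum_(i < m) g i (t ord0 i))%E.

(* Main.v *)
Require Import Defs.
From HB Require Import structures.
From mathcomp Require Import all_boot all_order all_algebra.
From mathcomp Require Import all_classical all_reals all_analysis.
From mathcomp Require Import ring lra.
Set Implicit Arguments.
Unset Strict Implicit.
Unset Printing Implicit Defensive.
Import Order.TTheory GRing.Theory Num.Theory.
Import numFieldNormedType.Exports.
Local Open Scope classical_set_scope.
Local Open Scope ring_scope.

(** Put h_i = g_i o A_i for i = 1, ..., m and h_(m+1) = f.  The problem defining
    S_p is to minimize the sum of the h_i.  Each block of the operator T has the
    form 2 J_i - I, where J_i is the resolvent of the subdifferential of h_i,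
    applied after x |-> 2 average x - x, the reflection of X^(m+1) across its
    diagonal.  A reflection across a subspace is an isometry and 2 J_i - I is
    nonexpansive because subdifferentials are monotone; hence T is nonexpansive
    (consensus_DR_nonexpansive).  That the explicit formula with A_i A_i^* is the
    resolvent of g_i o A_i is comp_resolvent; the adjoints exist by the Riesz
    theorem, itself read off from the proximity operator of a linear form.

    A point x is fixed by T iff average x - x_i is a subgradient of h_i at
    average x for every i, and these m + 1 vectors always add up to 0.  So the
    average of a fixed point minimizes the sum of the h_i.  Conversely a minimizer
    is the average of a fixed point as soon as it carries subgradients of the h_i
    that add up to 0.  They come from a Lagrange multiplier in R^m
    (multiplier_exists), built one coordinate at a time as in the Hahn-Banach
    theorem; the qualification condition makes the two sides of each extension
    step nonempty together.  Therefore average maps Fix T onto S_p, and minimizing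
    Theta = Psi o average over Fix T is the same as minimizing Psi over S_p
    (average_Fix).

    It remains to prove that the hybrid steepest descent method converges in
    finite dimension when the fixed point set is bounded
    (hybrid_steepest_descent).  The relaxed operator U = (1 - alpha) I + alpha T
    satisfies |U x - p|^2 <= |x - p|^2 - c |x - U x|^2 for fixed points p.  Outside a large
    ball, compactness of its boundary sphere and monotonicity of I - U make U
    decrease the distance to p by a fixed amount, which absorbs the linear drift of
    the gradient steps once they are small; the remaining quadratic growth is
    summable since the steps are square summable, so the trajectory is bounded.
    Then the squared distance d_n to the set Gamma of solutions satisfies
    d_(n+1) <= d_n - c |z_n - U z_n|^2 - 2 lam_n (Theta (U z_n) - min Theta)
    + O(lam_n^2), and by compactness one of the two negative terms is substantial
    whenever d_n is not small.  As the steps are not summable, d_n tends to 0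
    (divergent_descent).  Finally average is 1-Lipschitz and maps Gamma into
    Omega. *)

(** * Inner products *)

Section InnerProduct.
Context {R : realType} {X : hilbertType R}.
Implicit Types (x y z : X) (a : R).

Lemma innerDl x y z : inner (x + y) z = inner x z + inner y z.
Proof. exact: linearDl. Qed.

Lemma innerDr x y z : inner z (x + y) = inner z x + inner z y.
Proof. exact: linearDr. Qed.

Lemma innerBl x y z : inner (x - y) z = inner x z - inner y z.
Proof. exact: linearBl. Qed.

Lemma innerZl a x y : inner (a *: x) y = a * inner x y.
Proof. exact: linearZl_LR. Qed.

Lemma innerZr a x y : inner x (a *: y) = a * inner x y.
Proof. exact: linearZr_LR. Qed.

Lemma innerNl x y : inner (- x) y = - inner x y.
Proof. exact: linearNl. Qed.

Lemma innerNr x y : inner x (- y) = - inner x y.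
Proof. exact: linearNr. Qed.

Lemma inner0l x : inner 0 x = 0.
Proof. exact: linear0l. Qed.

Lemma inner0r x : inner x 0 = 0.
Proof. exact: linear0r. Qed.

Lemma inner_suml (I : Type) (r : seq I) (P : pred I) (F : I -> X) z :
  inner (\sum_(i <- r | P i) F i) z = \sum_(i <- r | P i) inner (F i) z.
Proof.
elim/big_rec2: _ => [|i a b _ <-]; first exact: inner0l.
exact: innerDl.
Qed.

Lemma normD_sqr x y : `|x + y| ^+ 2 = `|x| ^+ 2 + 2 * inner x y + `|y| ^+ 2.
Proof.
by rewrite -!inner_norm !(innerDl, innerDr) (innerC y x); ring.
Qed.

Lemma normB_sqr x y : `|x - y| ^+ 2 = `|x| ^+ 2 - 2 * inner x y + `|y| ^+ 2.
Proof. by rewrite normD_sqr normrN innerNr; ring. Qed.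

Lemma normZ_sqr a x : `|a *: x| ^+ 2 = a ^+ 2 * `|x| ^+ 2.
Proof. by rewrite normrZ exprMn real_normK// num_real. Qed.

Lemma inner_le_norm x y : inner x y <= `|x| * `|y|.
Proof.
have [->|y0] := eqVneq y 0; first by rewrite inner0r mulr_ge0.
have c0 : 0 < `|y| by rewrite normr_gt0.
have := sqr_ge0 `| `|y| *: x - `|x| *: y|.
rewrite normB_sqr !normZ_sqr innerZl innerZr => h.
have [->|x0] := eqVneq x 0; first by rewrite inner0l mulr_ge0.
have d0 : 0 < `|x| by rewrite normr_gt0.
suff : 0 <= (2 * (`|x| * `|y|)) * (`|x| * `|y| - inner x y).
  by rewrite pmulr_rge0 ?subr_ge0// !mulr_gt0.
by apply: le_trans h _; rewrite le_eqVlt; apply/orP; left; apply/eqP; ring.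
Qed.

Lemma normr_le_sqr (V W : normedModType R) (x : V) (y : W) :
  (`|x| <= `|y|) = (`|x| ^+ 2 <= `|y| ^+ 2).
Proof. by rewrite ler_pXn2r ?nnegrE. Qed.

Lemma inner_inj x y : (forall h, inner x h = inner y h) -> x = y.
Proof.
move=> xy; apply/eqP; rewrite -subr_eq0 -normr_eq0 -sqrf_eq0 -inner_norm.
by rewrite innerBl xy subrr.
Qed.

End InnerProduct.

(** Linear identities between vectors are reduced to identities between reals by
    testing them against an arbitrary vector. *)
Ltac vector_field := apply: inner_inj => ?;
  rewrite ?(innerDl, innerNl, innerZl, inner0l); field.

Section RealLine.
Context (R : realType).

(** The real line is a Hilbert space, so that what is proved about proximity
    operators applies to the functions g_i. *)
Definition real_inner (x y : R^o) : R := x * y.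

Let real_inner_bilinear : bilinear_for
  (GRing.Scale.Law.clone _ _ *%R _)
  (GRing.Scale.Law.clone _ _ ((@idfun R) \; *%R) _) real_inner.
Proof.
split=> [y|y] a x z /=; rewrite /real_inner.
  by rewrite mulrDl -mulrA.
by rewrite mulrDr mulrCA.
Qed.

HB.instance Definition _ :=
  bilinear_isBilinear.Build R R^o R^o R _ _ real_inner real_inner_bilinear.

Let real_inner_herm (x y : R^o) :
  real_inner x y = (-1) ^+ false * idfun (real_inner y x).
Proof. by rewrite expr0 mul1r /real_inner mulrC. Qed.

HB.instance Definition _ :=
  isHermitianSesquilinear.Build R R^o false idfun real_inner real_inner_herm.

Let real_inner_gt0 (x : R^o) : x != 0 -> 0 < real_inner x x.
Proof. by move=> x0; rewrite /real_inner -expr2 exprn_even_gt0. Qed.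

HB.instance Definition _ := isDotProduct.Build R R^o real_inner real_inner_gt0.

Let real_inner_norm (x : R^o) : real_inner x x = `|x| ^+ 2.
Proof. by rewrite /real_inner -expr2 real_normK// num_real. Qed.

HB.instance Definition _ :=
  CompleteNormedModule_isHilbert.Build R R^o real_inner_norm.

Lemma real_innerE (x y : R^o) : inner x y = x * y.
Proof. by []. Qed.

End RealLine.

(** * Subdifferentials and proximity operators *)

Section Subdifferential.
Context {R : realType} {X : hilbertType R}.
Implicit Types (h : X -> \bar R) (J : X -> X) (x y p v : X).

Definition subdiff h p : set X := [set v | h p \is a fin_num /\
  forall y, (h p + (inner v (y - p))%:E <= h y)%E].

(** That is, J = (I + subdiff h)^-1.  This characterization of proximity operators
    survives the composition of h with a linear form. *)
Definition resolvent h J : Prop := forall x, subdiff h (J x) (x - J x).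

Lemma subdiff_monotone h p q v w :
  subdiff h p v -> subdiff h q w -> 0 <= inner (v - w) (p - q).
Proof.
move=> [hp /(_ q) vpq] [hq /(_ p) wqp].
move: vpq wqp; rewrite -(fineK hp) -(fineK hq) -!EFinD !lee_fin.
rewrite -(opprB p q) innerNr innerBl; lra.
Qed.

Lemma resolvent_unique h J x p :
  resolvent h J -> subdiff h p (x - p) -> J x = p.
Proof.
move=> /(_ x) /subdiff_monotone hJ /hJ.
rewrite (_ : x - J x - (x - p) = - (J x - p)); last by vector_field.
rewrite innerNl inner_norm oppr_ge0 => le0.
apply/eqP; rewrite -subr_eq0 -normr_eq0 -sqrf_eq0 eq_le le0/=.
exact: sqr_ge0.
Qed.

(** Monotonicity at J x and J y reads |J x - J y|^2 <= <x - y, J x - J y>, and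
    expanding the squares turns this into the nonexpansiveness of 2 J - I. *)
Lemma resolvent_reflection h J x y : resolvent h J ->
  `|(2 *: J x - x) - (2 *: J y - y)| <= `|x - y|.
Proof.
move=> hJ; have := subdiff_monotone (hJ x) (hJ y).
set d := J x - J y; set e := x - y.
rewrite (_ : x - J x - (y - J y) = e - d); last by rewrite /e /d; vector_field.
rewrite (_ : 2 *: J x - x - (2 *: J y - y) = 2 *: d - e); last first.
  by rewrite /e /d; vector_field.
clearbody d e.
rewrite innerBl inner_norm normr_le_sqr normB_sqr normZ_sqr innerZl innerC.
lra.
Qed.

End Subdifferential.

Section Gamma0Theory.
Context {R : realType} {X : normedModType R} {f : X -> \bar R}.
Hypothesis f_Gamma0 : Gamma0 X f.

Lemma Gamma0_dom x : dom f x = (f x \is a fin_num) :> Prop.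
Proof.
have [[/(_ x) fx _] _ _] := f_Gamma0.
rewrite fin_numE fx /= /dom /= ltey; done.
Qed.

Lemma Gamma0_dom_fin x : dom f x -> f x \is a fin_num.
Proof. by rewrite Gamma0_dom. Qed.

(** A real-valued form of convexity, which avoids extended arithmetic. *)
Lemma Gamma0_convex x y t : dom f x -> dom f y -> 0 < t < 1 ->
  dom f (t *: x + (1 - t) *: y) /\
  fine (f (t *: x + (1 - t) *: y)) <= t * fine (f x) + (1 - t) * fine (f y).
Proof.
move=> fx fy t01; have [_ _ /(_ x y t t01)] := f_Gamma0.
rewrite -(fineK (Gamma0_dom_fin fx)) -(fineK (Gamma0_dom_fin fy)).
rewrite -!EFinM -EFinD => fxy.
have fz : dom f (t *: x + (1 - t) *: y).
  by rewrite /dom/=; apply: le_lt_trans fxy _; rewrite ltry.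
by split => //; rewrite -lee_fin (fineK (Gamma0_dom_fin fz)).
Qed.

End Gamma0Theory.

Section Prox.
Context {R : realType} {X : hilbertType R} {f : X -> \bar R}.
Hypothesis f_Gamma0 : Gamma0 X f.

(** Lower semicontinuity at a point x0 of the domain bounds f from below by
    f x0 - 1 on a ball of radius r.  A point at distance d >= r from x0 is reached
    from that ball by following a segment issued from x0, and convexity along it
    costs at most 2 d / r. *)
Lemma Gamma0_affine_minorant : exists (x0 : X) (a b : R), 0 <= b /\
  forall y, dom f y -> a - b * `|y - x0| <= fine (f y).
Proof.
have [[_ [x0 fx0]] flsc _] := f_Gamma0.
pose c := fine (f x0).
have : ((c - 1)%:E < f x0)%E.
  by rewrite -(fineK (Gamma0_dom_fin f_Gamma0 fx0)) lte_fin ltrBlDr ltrDl.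
case/flsc => V /nbhs_ballP[r /= r0 rV] Vf.
exists x0, (c - 1), (2 / r); split; first by rewrite divr_ge0// ltW.
move=> y fy; have [yr|ry] := ltP `|x0 - y| r.
  have : ((c - 1)%:E < f y)%E by apply/Vf/rV; rewrite -ball_normE.
  rewrite -(fineK (Gamma0_dom_fin f_Gamma0 fy)) lte_fin /= => /ltW; apply: le_trans.
  by rewrite lerBlDr lerDl mulr_ge0// divr_ge0// ltW.
rewrite distrC in ry.
have d0 : 0 < `|y - x0| by exact: lt_le_trans ry.
pose t := r / (2 * `|y - x0|).
have t01 : 0 < t < 1.
  rewrite /t divr_gt0 ?mulr_gt0//= ltr_pdivrMr ?mulr_gt0//; lra.
have [fz] := Gamma0_convex f_Gamma0 fy fx0 t01.
have : ((c - 1)%:E < f (t *: y + (1 - t) *: x0)%R)%E.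
  apply/Vf/rV; rewrite -ball_normE /=.
  rewrite (_ : x0 - _ = - (t *: (y - x0))); last first.
    by vector_field.
  rewrite normrN normrZ gtr0_norm; last by case/andP: t01.
  rewrite /t invfM mulrA mulfVK ?gt_eqF//; lra.
rewrite -(fineK (Gamma0_dom_fin f_Gamma0 fz)) lte_fin -/c => h1 h2.
have {h1 h2} : - 1 <= t * (fine (f y) - c) by lra.
have -> : 2 / r * `|y - x0| = t^-1.
  by rewrite /t invf_div mulrAC.
rewrite -lter_pdivrMl; last by case/andP: t01.
lra.
Qed.
Variable x : X.

Let phi y := fine (f y) + 2^-1 * `|x - y| ^+ 2.

Let phi_lb : exists b, forall y, dom f y -> b <= phi y.
Proof.
have [x0 [a [b [b0 ab]]]] := Gamma0_affine_minorant.
exists (a - b * `|x - x0| - 2^-1 * b ^+ 2) => y /ab.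
have := ler_distD x y x0; rewrite /phi (distrC y x).
set s := `|x - y|; set t := `|x - x0|; set r := `|y - x0| => h.
have := ler_wpM2l b0 h.
have := sqr_ge0 (s - b).
lra.
Qed.

(** The quadratic term makes phi strongly convex: by the parallelogram identity,
    two almost minimizers are close to each other. *)
Let phi_midpoint y z : dom f y -> dom f z ->
  exists2 w, dom f w &
    `|y - z| ^+ 2 <= 4 * (phi y + phi z - 2 * phi w).
Proof.
move=> fy fz; have t01 : 0 < (2^-1 : R) < 1 by apply/andP; split; lra.
have [fw wyz] := Gamma0_convex f_Gamma0 fy fz t01.
exists (2^-1 *: y + (1 - 2^-1) *: z) => //; rewrite /phi.
set w := 2^-1 *: y + (1 - 2^-1) *: z in fw wyz *.
rewrite (_ : x - w = 2^-1 *: ((x - y) + (x - z))); last by rewrite /w; vector_field.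
rewrite (_ : y - z = (x - z) - (x - y)); last by vector_field.
move: (x - y) (x - z) => a b.
rewrite normZ_sqr normB_sqr normD_sqr (innerC b); lra.
Qed.

(** A minimizing sequence is Cauchy by the midpoint inequality, and lower
    semicontinuity shows that its limit is a minimizer. *)
Lemma prox_exists :
  argmin (fun y => f y + (2^-1 * `|x - y| ^+ 2)%:E)%E setT !=set0.
Proof.
have [[_ [x0 fx0]] flsc _] := f_Gamma0.
have [b hb] := phi_lb.
pose I := inf [set phi y | y in dom f].
have I_lb y : dom f y -> I <= phi y.
  by move=> fy; apply: ge_inf; [exists b => _ [z /hb + <-]|exists y].
have near_inf n : exists y, dom f y /\ phi y < I + n.+1%:R^-1.
  have S0 : [set phi y | y in dom f] !=set0 by exists (phi x0), x0.
  have [|_ [y fy <-] yI] := inf_lt (x := I + n.+1%:R^-1) S0; last by exists y.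
  by rewrite ltrDl invr_gt0.
have [u hu] := choice near_inf.
have fu n : dom f (u n) by have [] := hu n.
have uI n : phi (u n) < I + n.+1%:R^-1 by have [] := hu n.
have u_dist n k : `|u n - u k| ^+ 2 <= 4 * (n.+1%:R^-1 + k.+1%:R^-1).
  have [w /I_lb fw /le_trans] := phi_midpoint (fu n) (fu k); apply.
  move: fw (uI n) (uI k); move: (phi w) (phi (u n)) (phi (u k)) => ? ? ?.
  move: n.+1%:R^-1 k.+1%:R^-1 => ? ?; lra.
have u_cvg : cvgn u.
  apply: cauchy_cvg; apply: cauchy_exP => e e0.
  have e80 : 0 < 8^-1 * e ^+ 2 by rewrite mulr_gt0// exprn_gt0.
  have [N _ Ne] := near_infty_natSinv_lt (PosNum e80).
  exists (u N); exists N => // n /= Nn; rewrite -ball_normE /=.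
  rewrite -(@ltr_pXn2r _ 2) ?nnegrE ?(ltW e0)//.
  apply: le_lt_trans (u_dist N n) _.
  move: (Ne N (leqnn N)) (Ne n Nn) => /=.
  move: N.+1%:R^-1 n.+1%:R^-1 => ? ?; lra.
pose p := limn u.
have u_p : `|x - u n| @[n --> \oo] --> `|x - p|.
  by apply: cvg_norm; apply: cvgB; [exact: cvg_cst|].
have f_p : (f p <= (I - 2^-1 * `|x - p| ^+ 2)%:E)%E.
  rewrite leNgt; apply/negP => Ifp.
  have [a Ia afp] : exists2 a, I - 2^-1 * `|x - p| ^+ 2 < a & (a%:E < f p)%E.
    case: (f p) Ifp => [r| |]//.
      rewrite lte_fin => Ir; exists ((I - 2^-1 * `|x - p| ^+ 2 + r) / 2).
        by rewrite midf_lt.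
      by rewrite lte_fin midf_lt.
    by move=> _; exists (I - 2^-1 * `|x - p| ^+ 2 + 1); rewrite ?ltrDl// ltry.
  have [V Vp Va] := flsc _ _ afp.
  pose e := (2^-1 * `|x - p| ^+ 2 - (I - a)) / 2.
  have e0 : 0 < e by rewrite /e divr_gt0//; lra.
  have u_p2 : 2^-1 * `|x - u n| ^+ 2 @[n --> \oo] --> 2^-1 * `|x - p| ^+ 2.
    by apply: cvgM; [exact: cvg_cst|rewrite expr2; apply: cvgM].
  have : \forall n \near \oo, I + e < phi (u n) /\ n.+1%:R^-1 < e.
    near=> n; split; last by near: n; exact: (near_infty_natSinv_lt (PosNum e0)).
    have : (a%:E < f (u n))%E by apply: Va; near: n; exact: u_cvg.
    rewrite -(fineK (Gamma0_dom_fin f_Gamma0 (fu n))) lte_fin.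
    have : 2^-1 * `|x - p| ^+ 2 - e < 2^-1 * `|x - u n| ^+ 2.
      by near: n; apply: (cvgr_gt _ u_p2); rewrite ltrBlDr ltrDl.
    rewrite /phi /e; lra.
  case=> N _ /(_ N (leqnn N)) [h1 h2].
  move: (uI N) h1 h2; move: (phi _) N.+1%:R^-1 => ? ?; lra.
have fp : dom f p by rewrite /dom/=; apply: le_lt_trans f_p _; rewrite ltry.
exists p; split=> // y _ /=.
have [fy|] := pselect (dom f y); last first.
  rewrite /dom/= => /negP; rewrite -leNgt leye_eq => /eqP ->.
  by rewrite addye// leey.
have := I_lb y fy; move: f_p; rewrite /phi.
rewrite -(fineK (Gamma0_dom_fin f_Gamma0 fp)).
rewrite -(fineK (Gamma0_dom_fin f_Gamma0 fy)) -!EFinD !lee_fin; lra.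
Unshelve. all: by end_near. Qed.

Lemma prox_argmin :
  argmin (fun y => f y + (2^-1 * `|x - y| ^+ 2)%:E)%E setT (prox f x).
Proof. by apply: xgetPex; exact: prox_exists. Qed.

(** Comparing the minimizer p with p + t (y - p) and dividing by t leaves the
    subgradient inequality up to an error that is linear in t. *)
Lemma prox_subdiff : subdiff f (prox f x) (x - prox f x).
Proof.
set p := prox f x; have [_ p_min] := prox_argmin; rewrite -/p in p_min.
have fp : dom f p.
  have [[_ [x0 fx0]] _ _] := f_Gamma0.
  have := p_min x0 I; rewrite /= -(fineK (Gamma0_dom_fin f_Gamma0 fx0)).
  rewrite /dom /=; case: (f p) => [r _| |_]; rewrite ?ltry// ?ltNyr//.
split=> [|y]; first exact: Gamma0_dom_fin.
have [fy|] := pselect (dom f y); last first.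
  rewrite /dom/= => /negP; rewrite -leNgt leye_eq => /eqP ->; exact: leey.
have step t : 0 < t < 1 ->
    fine (f p) + inner (x - p) (y - p) <= fine (f y) + t / 2 * `|y - p| ^+ 2.
  move=> t01; have [fz cz] := Gamma0_convex f_Gamma0 fy fp t01.
  have := p_min (t *: y + (1 - t) *: p) I; move: cz.
  rewrite -[X in (_ <= X + _)%E](fineK (Gamma0_dom_fin f_Gamma0 fz)).
  rewrite -[X in (X + _ <= _)%E](fineK (Gamma0_dom_fin f_Gamma0 fp)).
  rewrite -!EFinD lee_fin.
  rewrite [X in _ -> _ <= _ + _ * `|X| ^+ 2 -> _](_ : _ =
    (x - p) - t *: (y - p)); last by vector_field.
  rewrite (normB_sqr (x - p)) normZ_sqr innerZr.
  case/andP: t01 => t0 _.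
  move=> h1 h2; rewrite -(ler_pM2l t0); lra.
rewrite -(fineK (Gamma0_dom_fin f_Gamma0 fp)).
rewrite -(fineK (Gamma0_dom_fin f_Gamma0 fy)) -EFinD lee_fin.
apply/ler_addgt0Pr => e e0.
pose t := Num.min (2^-1) (e / (1 + `|y - p| ^+ 2)).
have n0 := sqr_ge0 `|y - p|.
have n1 : 0 < 1 + `|y - p| ^+ 2 by lra.
have t01 : 0 < t < 1.
  rewrite /t; apply/andP; split; first by rewrite lt_min divr_gt0// andbT; lra.
  by rewrite gt_min; apply/orP; left; lra.
apply: le_trans (step t t01) _; rewrite lerD2l.
case/andP: t01 => t0 _.
have te : t * (1 + `|y - p| ^+ 2) <= e.
  by rewrite -ler_pdivlMr// ge_min lexx orbT.
have := mulr_ge0 (ltW t0) n0; lra.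
Qed.

End Prox.

Lemma prox_resolvent {R : realType} {X : hilbertType R} (f : X -> \bar R) :
  Gamma0 X f -> resolvent f (prox f).
Proof. by move=> f_Gamma0 x; exact: prox_subdiff. Qed.

(** * Adjoints of linear forms and the resolvent of g o A *)

Section Riesz.
Context {R : realType} {X : hilbertType R} (A : {linear X -> R}).
Hypothesis A_bounded : bounded_near A (nbhs (0 : X)).

Let A_continuous : continuous A.
Proof. exact: (bounded_linear_continuous (f := A : {linear X -> R^o})). Qed.

Let AZ a x : A (a *: x) = a * A x.
Proof. exact: linearZ. Qed.

Let opp_Gamma0 t : Gamma0 X (fun x => (- (t * A x))%:E).
Proof.
split; first by split=> // ; exists 0; rewrite /dom /= ltry.
  move=> x a; rewrite lte_fin => ax.
  have cA : - (t * A y) @[y --> x] --> - (t * A x).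
    by apply: cvgN; apply: cvgM; [exact: cvg_cst|exact: A_continuous].
  by exists [set y | a < - (t * A y)] => //; exact: (cvgr_gt _ cA).
move=> x y s _; rewrite -!EFinM -EFinD lee_fin linearD /= !AZ.
lra.
Qed.

(** The representative of t A is the proximal point p of 0 for the function - t A:
    the subgradient inequality at p + h and at p - h forces equality. *)
Lemma riesz t : exists v, forall x, inner v x = t * A x.
Proof.
have [_ pP] := prox_subdiff (opp_Gamma0 t) 0.
set p := prox _ 0 in pP; exists p => h.
have := pP (p + h); have := pP (p - h).
rewrite -!EFinD !lee_fin sub0r.
rewrite [p - h - p](_ : _ = - h); last by vector_field.
rewrite [p + h - p](_ : _ = h); last by vector_field.
rewrite linearB linearD /= !innerNl innerNr; lra.
Qed.

Lemma adjointP t x : inner (adjoint A t) x = t * A x.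
Proof. exact: (xgetPex 0 (riesz t)). Qed.

Lemma adjointZ t : adjoint A t = t *: adjoint A 1.
Proof. by apply: inner_inj => x; rewrite innerZl !adjointP mul1r. Qed.

Lemma adjoint1E x : inner (adjoint A 1) x = A x.
Proof. by rewrite adjointP mul1r. Qed.

Lemma gram_gt0 : (A : X -> R) <> cst 0 -> 0 < gram A.
Proof.
move=> A0; rewrite /gram -adjoint1E inner_norm exprn_gt0// normr_gt0.
apply/eqP => a0; apply: A0; apply/funext => x.
by rewrite -adjoint1E a0 inner0l.
Qed.

Lemma subdiff_comp (g : R -> \bar R) x u :
  subdiff (g : R^o -> \bar R) (A x) u ->
  subdiff (g \o A) x (adjoint A u).
Proof.
move=> [gx gu]; split=> // y; have := gu (A y).
by rewrite /= real_innerE adjointP linearB.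
Qed.

End Riesz.

Lemma Gamma0_scale {R : realType} (X : normedModType R) (g : X -> \bar R)
    (c : R) : 0 < c -> Gamma0 X g -> Gamma0 X (fun t => c%:E * g t)%E.
Proof.
move=> c0 [[gNoo [t gt]] glsc gcvx]; split.
- split=> [x|].
    by have := gNoo x; case: (g x) => [r| |]//=; rewrite gt0_muley ?lte_fin.
  by exists t; move: gt; rewrite /dom/= => gt; rewrite lte_mul_pinfty// lee_fin ltW.
- move=> x a /=; rewrite muleC -lte_pdivrMr// -EFinM => /glsc[V Vx Va].
  by exists V => // y /Va; rewrite [in X in _ -> X]muleC -lte_pdivrMr.
- move=> x y s s01; have := gcvx x y s s01.
  rewrite -(@lee_pmul2l _ c%:E) ?lte_fin// => /le_trans; apply.
  case/andP: s01 => s0 s1; have s1' : (0 < 1 - s)%R by rewrite subr_gt0.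
  have := gNoo x; have := gNoo y.
  case: (g x) (g y) => [a| |] [b| |]// _ _.
  + rewrite -!EFinM -!EFinD lee_fin; rewrite le_eqVlt; apply/orP; left; apply/eqP; ring.
  + by rewrite [leRHS](_ : _ = +oo%E) ?leey// !gt0_muley ?lte_fin// addey.
  + by rewrite [leRHS](_ : _ = +oo%E) ?leey// !gt0_muley ?lte_fin// addye.
  + by rewrite [leRHS](_ : _ = +oo%E) ?leey// !gt0_muley ?lte_fin// addye.
Qed.

(** The point y is moved along the adjoint of A until A y reaches the scaled
    proximal point q.  The displacement is then a multiple of the adjoint, so its
    inner product with x - p only involves A x - q, and the inequality in R that
    characterizes q, divided by gram A, is the required one in X. *)
Lemma comp_resolvent {R : realType} {X : hilbertType R} (A : {linear X -> R})
    (g : R -> \bar R) :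
  bounded_near A (nbhs (0 : X)) -> (A : X -> R) <> cst 0 -> Gamma0 R g ->
  resolvent (g \o A) (fun y => y + (gram A)^-1 *:
    adjoint A (prox (fun t => (gram A)%:E * g t)%E (A y) - A y)).
Proof.
move=> Abnd A0 g_Gamma0 y; have c0 := gram_gt0 Abnd A0.
have cV := gt_eqF c0.
set c := gram A in c0 cV *.
have [] := prox_resolvent (X := R^o) (Gamma0_scale c0 g_Gamma0) (A y).
set q := prox _ _ => gq hq.
set p := y + _.
have Ap : A p = q.
  rewrite /p linearD linearZ /= adjointZ// linearZ /= -/(gram A) -/c.
  rewrite /GRing.scale /=; field.
  by rewrite cV.
have gq' : g q \is a fin_num.
  move: gq; case: (g q) => //=; rewrite /c.
    by rewrite gt0_muley ?lte_fin.
  by rewrite gt0_muleNy ?lte_fin.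
split; rewrite /= ?Ap// => x.
have -> : inner (y - p) (x - p) = c^-1 * ((A y - q) * (A x - q)).
  rewrite (_ : y - p = - (c^-1 *: adjoint A (q - A y))); last first.
    by rewrite /p opprD addNKr.
  rewrite innerNl innerZl adjointP// [A (x - p)]linearB Ap /=; ring.
have := hq (A x); rewrite real_innerE -(fineK gq') -EFinM -EFinD.
have gx : g (A x) != -oo%E by case: g_Gamma0 => -[].
case: (g (A x)) gx => [r _|_ _|]//; last by rewrite leey.
rewrite -EFinM -!EFinD !lee_fin => h.
rewrite -(ler_pM2l c0) mulrDr mulVKf ?cV//; exact: h.
Qed.

Lemma nonexpansiveP {R : realType} {X : hilbertType R} (T : X -> X) :
  nonexpansive T <-> forall x y, `|T x - T y| <= `|x - y|.
Proof.
split=> [h x y|h [x y] _]; last by rewrite /= mul1r; exact: h.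
by have := h (x, y); rewrite /= mul1r; apply.
Qed.

(** * Douglas-Rachford operators on a product space *)

Section Consensus.
Context {R : realType} {X : hilbertType R} (k : nat).
Local Notation H := (hprod k.+1 X).
Implicit Types (x y z : H) (J : 'I_k.+1 -> X -> X).

Lemma hprod_norm_sqrE x : `|x| ^+ 2 = \sum_i `|x i| ^+ 2.
Proof.
by rewrite -inner_norm hprod_innerE; apply: eq_bigr => i _; rewrite inner_norm.
Qed.

Lemma averageP x : \sum_i x i = k.+1%:R *: average x.
Proof. by rewrite /average scalerA divff ?scale1r// pnatr_eq0. Qed.

Lemma averageD x y : average (x + y) = average x + average y.
Proof.
rewrite /average -scalerDr -big_split /=; congr (_ *: _).
by apply: eq_bigr => i _; rewrite ffunE.
Qed.

Lemma averageZ (a : R) x : average (a *: x) = a *: average x.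
Proof.
rewrite /average scalerA mulrC -scalerA; congr (_ *: _); rewrite scaler_sumr.
by apply: eq_bigr => i _; rewrite ffunE.
Qed.

Lemma averageB x y : average (x - y) = average x - average y.
Proof. by rewrite -scaleN1r averageD averageZ scaleN1r. Qed.

(** The orthogonality of x - average x to the diagonal, summed over the blocks. *)
Lemma sum_average_inner x : \sum_i inner (x i) (average x) = k.+1%:R * `|average x| ^+ 2.
Proof. by rewrite -inner_suml averageP innerZl inner_norm. Qed.

(** The reflection across the diagonal of the product, whose orthogonal projection
    replaces every block by the average. *)
Definition consensus_reflection x : H := [ffun i => 2 *: average x - x i].

Lemma consensus_reflection_isometry x : `|consensus_reflection x| = `|x|.
Proof.
apply/eqP; rewrite -(@eqrXn2 _ 2)// !hprod_norm_sqrE; apply/eqP.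
rewrite (eq_bigr (fun i => 4 * `|average x| ^+ 2 +
    (- 4 * inner (x i) (average x) + `|x i| ^+ 2))); last first.
  by move=> i _; rewrite ffunE normB_sqr normZ_sqr innerZl innerC; ring.
rewrite !big_split /= !sumr_const card_ord -mulr_sumr sum_average_inner.
rewrite -mulr_natl; ring.
Qed.

Lemma average_norm x : `|average x| <= `|x|.
Proof.
rewrite normr_le_sqr hprod_norm_sqrE.
have : 0 <= \sum_i `|x i - average x| ^+ 2 by apply: sumr_ge0 => i _; exact: sqr_ge0.
rewrite (eq_bigr (fun i => `|x i| ^+ 2 +
    (- 2 * inner (x i) (average x) + `|average x| ^+ 2))); last first.
  by move=> i _; rewrite normB_sqr; ring.
rewrite !big_split /= !sumr_const card_ord -mulr_sumr sum_average_inner.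
rewrite -mulr_natl -natr1.
have := mulr_ge0 (ler0n R k) (sqr_ge0 `|average x|); lra.
Qed.

(** The Douglas-Rachford operator, reflection through the resolvents after
    reflection across the diagonal, for the problem of minimizing a sum of
    functions by duplicating the variable. *)
Definition consensus_DR J x : H :=
  [ffun i => 2 *: J i (consensus_reflection x i) - consensus_reflection x i].

Lemma consensus_DR_nonexpansive J (h : 'I_k.+1 -> X -> \bar R) :
  (forall i, resolvent (h i) (J i)) -> nonexpansive (consensus_DR J).
Proof.
move=> hJ; apply/nonexpansiveP => x y.
rewrite -[leRHS]consensus_reflection_isometry normr_le_sqr !hprod_norm_sqrE.
apply: ler_sum => i _.
rewrite -normr_le_sqr !ffunE; apply: le_trans (resolvent_reflection _ _ (hJ i)) _.
rewrite averageB.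
rewrite le_eqVlt; apply/orP; left; apply/eqP; congr `|_|.
by vector_field.
Qed.

(** At a fixed point x, the reflected block y = 2 average x - x_i satisfies
    J_i y = (x_i + y) / 2 = average x, so y - average x is a subgradient. *)
Lemma Fix_consensus_DR J (h : 'I_k.+1 -> X -> \bar R) x :
  (forall i, resolvent (h i) (J i)) -> Fix (consensus_DR J) x ->
  forall i, subdiff (h i) (average x) (average x - x i).
Proof.
move=> hJ /ffunP xT i; have := xT i; rewrite !ffunE.
set y := 2 *: average x - x i => Jy.
have Ja : J i y = average x.
  have -> : J i y = 2^-1 *: ((2 *: J i y - y) + y) by vector_field.
  by rewrite Jy /y; vector_field.
have := hJ i y; rewrite Ja.
by rewrite (_ : y - average x = average x - x i)// /y; vector_field.
Qed.

Lemma consensus_DR_Fix J (h : 'I_k.+1 -> X -> \bar R) (p : X) (v : 'I_k.+1 -> X) :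
  (forall i, resolvent (h i) (J i)) ->
  (forall i, subdiff (h i) p (v i)) -> \sum_i v i = 0 ->
  exists2 x, Fix (consensus_DR J) x & average x = p.
Proof.
move=> hJ hv v0; pose x : H := [ffun i => p - v i].
have xp : average x = p.
  rewrite /average (eq_bigr (fun i => p - v i)); last by move=> i _; rewrite ffunE.
  rewrite sumrB v0 subr0 sumr_const card_ord -(scaler_nat _ p) scalerA.
  by rewrite mulVf ?pnatr_eq0// scale1r.
exists x => //; apply/ffunP => i; rewrite !ffunE xp.
rewrite (_ : 2 *: p - (p - v i) = p + v i); last by vector_field.
rewrite (resolvent_unique (hJ i) (p := p)); first by vector_field.
by rewrite addrC addKr; exact: hv.
Qed.

End Consensus.

(** * Lagrange multipliers for convex programs *)

Section Multiplier.
Context {R : realType} {X : normedModType R} {m : nat}.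
Variables (F : X -> \bar R) (G : 'rV[R]_m -> \bar R) (L : {linear X -> 'rV[R]_m}).
Hypotheses (F_Gamma0 : Gamma0 X F) (G_Gamma0 : Gamma0 'rV[R]_m G).

Definition dotrow (w d : 'rV[R]_m) : R := \sum_j w ord0 j * d ord0 j.

Lemma dotrowDr w d e : dotrow w (d + e) = dotrow w d + dotrow w e.
Proof.
by rewrite /dotrow -big_split; apply: eq_bigr => j _; rewrite mxE mulrDr.
Qed.

Lemma dotrowZr w a d : dotrow w (a *: d) = a * dotrow w d.
Proof.
by rewrite /dotrow mulr_sumr; apply: eq_bigr => j _; rewrite mxE mulrCA.
Qed.

Let gap x u := u - L x.
Let val x u := fine (F x) + fine (G u).

Variable p : R.
Hypothesis p_lb : forall x, dom F x -> dom G (L x) -> p <= val x (L x).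

(* The algebraic content of 0 being in the relative interior of the set of
   gaps u - L x. *)
Hypothesis gap_sym : forall x u, dom F x -> dom G u -> exists x' u' l,
  [/\ dom F x', dom G u', 0 < l & gap x' u' = - l *: gap x u].

Let below k (d : 'rV[R]_m) := forall j : 'I_m, (k <= j)%N -> d ord0 j = 0.

(** The vector w supports the perturbed problem along the first k coordinate
    directions; m directions give a multiplier and 0 directions say that p is a
    lower bound. *)
Let multiplier_upto k w := forall x u, dom F x -> dom G u ->
  below k (gap x u) -> dotrow w (gap x u) <= val x u - p.

Let gap_convex x u x' u' t : dom F x -> dom G u -> dom F x' -> dom G u' ->
    0 < t < 1 -> exists y v, [/\ dom F y, dom G v,
      gap y v = t *: gap x u + (1 - t) *: gap x' u' &
      val y v <= t * val x u + (1 - t) * val x' u'].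
Proof.
move=> Fx Gu Fx' Gu' t01.
have [Fy Fyle] := Gamma0_convex F_Gamma0 Fx Fx' t01.
have [Gv Gvle] := Gamma0_convex G_Gamma0 Gu Gu' t01.
exists (t *: x + (1 - t) *: x'), (t *: u + (1 - t) *: u'); split => //.
  by rewrite /gap linearD !linearZ !scalerBr opprD addrACA.
rewrite /val; lra.
Qed.

(** Only the coordinate c of w along the new direction has to be found.  Feasible
    pairs whose gap is negative along this direction bound c from below, those with
    a positive gap bound it from above.  The convex combination of two such pairs
    that cancels the new coordinate shows that lower bounds do not exceed upper
    bounds, and by symmetry one kind of bound exists iff the other does. *)
Let multiplier_step k w : (k < m)%N -> multiplier_upto k w ->
  exists w', multiplier_upto k.+1 w'.
Proof.
move=> km wP; pose i := Ordinal km.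
pose dot0 d := dotrow w d - w ord0 i * d ord0 i.
pose w' c : 'rV[R]_m := \row_j (if j == i then c else w ord0 j).
have w'E c d : dotrow (w' c) d = dot0 d + c * d ord0 i.
  have dw : dotrow w d = w ord0 i * d ord0 i +
      \sum_(j | j != i) w ord0 j * d ord0 j by rewrite /dotrow (bigD1 i).
  rewrite /dot0 dw /dotrow (bigD1 i)//= mxE eqxx.
  rewrite (eq_bigr (fun j => w ord0 j * d ord0 j)); last first.
    by move=> j /negbTE ji; rewrite mxE ji.
  by ring.
have belowS d : below k.+1 d -> d ord0 i = 0 -> below k d.
  move=> dk di j; rewrite leq_eqVlt => /orP[/eqP kj|]; last exact: dk.
  by rewrite (_ : j = i)//; exact/val_inj.
pose feas x u := [/\ dom F x, dom G u & below k.+1 (gap x u)].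
pose slope x u := (dot0 (gap x u) - (val x u - p)) / - gap x u ord0 i.
pose lo := [set r | exists x u, [/\ feas x u, gap x u ord0 i < 0 & r = slope x u]].
pose hi := [set r | exists x u, [/\ feas x u, 0 < gap x u ord0 i & r = slope x u]].
have feas_sym x u : feas x u -> exists x' u' l,
    [/\ feas x' u', 0 < l & gap x' u' ord0 i = - l * gap x u ord0 i].
  case=> Fx Gu xu; have [x' [u' [l [Fx' Gu' l0 gE]]]] := gap_sym Fx Gu.
  exists x', u', l; split => //; last by rewrite gE mxE.
  by split => // j /xu d0; rewrite gE mxE d0 mulr0.
have lo_hi a b : lo a -> hi b -> a <= b.
  move=> [x [u [[Fx Gu xu] s1 ->]]] [x' [u' [[Fx' Gu' xu'] s2 ->]]].
  move: s1 s2; rewrite /slope.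
  set s := gap x u ord0 i; set s' := gap x' u' ord0 i => s0 s'0.
  have ss' : 0 < s' - s by lra.
  pose t := s' / (s' - s).
  have t01 : 0 < t < 1.
    by rewrite /t divr_gt0//= ltr_pdivrMr//; lra.
  (* The weight t is the one for which the new coordinate of the gap vanishes. *)
  have [y [v [Fy Gv gyv vyv]]] := gap_convex Fx Gu Fx' Gu' t01.
  have gi : gap y v ord0 i = 0.
    rewrite gyv mxE [X in X + _]mxE [X in _ + X]mxE -/s -/s' /t; field; lra.
  have yv : below k (gap y v).
    apply: belowS => // j kj; rewrite gyv mxE [X in X + _]mxE [X in _ + X]mxE.
    by rewrite xu// xu'// !mulr0 addr0.
  have := wP y v Fy Gv yv.
  rewrite gyv dotrowDr !dotrowZr => h.
  have {}h := le_trans h (lerB vyv (lexx p)).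
  move: h; rewrite -(ler_pM2l ss').
  set D := dotrow w (gap x u); set D' := dotrow w (gap x' u').
  set V := val x u; set V' := val x' u'.
  have -> : (s' - s) * (t * D + (1 - t) * D') = s' * D - s * D'.
    by rewrite /t; field; lra.
  have -> : (s' - s) * (t * V + (1 - t) * V' - p) = s' * V - s * V' - (s' - s) * p.
    by rewrite /t; field; lra.
  move=> h; rewrite ler_pdivrMr ?oppr_gt0// mulrAC ler_ndivlMr ?oppr_lt0//.
  rewrite /dot0 -/s -/s' -/D -/D'; lra.
pose c := sup lo.
have loP x u : feas x u -> gap x u ord0 i < 0 -> slope x u <= c.
  move=> xu s0; have [x' [u' [l [xu' l0 s'E]]]] := feas_sym _ _ xu.
  apply: ub_le_sup; last by exists x, u.
  exists (slope x' u') => a loa; apply: lo_hi => //.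
  by exists x', u'; split=> //; rewrite s'E nmulr_rgt0// oppr_lt0.
have hiP x u : feas x u -> 0 < gap x u ord0 i -> c <= slope x u.
  move=> xu s0; have [x' [u' [l [xu' l0 s'E]]]] := feas_sym _ _ xu.
  apply: ge_sup; last by move=> a loa; apply: lo_hi => //; exists x, u.
  exists (slope x' u'), x', u'; split => //.
  by rewrite s'E nmulr_rlt0// oppr_lt0.
exists (w' c) => x u Fx Gu xu; rewrite w'E.
have xuf : feas x u by split.
case: (ltgtP (gap x u ord0 i) 0) => [s0|s0|s0].
- have := loP _ _ xuf s0; rewrite /slope ler_pdivrMr ?oppr_gt0//; lra.
- have := hiP _ _ xuf s0; rewrite /slope invrN mulrN -mulNr ler_pdivlMr//; lra.
- by have := wP x u Fx Gu (belowS _ xu s0); rewrite /dot0 s0; lra.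
Qed.

(** A form of the Fenchel-Rockafellar duality theorem with finitely many linear
    constraints: the optimal value is attained by an affine minorant of the value
    function u - L x |-> F x + G u. *)
Lemma multiplier_exists : exists w, forall x u, dom F x -> dom G u ->
  dotrow w (u - L x) <= fine (F x) + fine (G u) - p.
Proof.
have upto k : (k <= m)%N -> exists w, multiplier_upto k w.
  elim: k => [_|k IH km]; last first.
    by have [w wP] := IH (ltnW km); exact: (multiplier_step km wP).
  exists 0 => x u Fx Gu xu0.
  have uE : u = L x.
    apply/eqP; rewrite -subr_eq0; apply/eqP/rowP => j.
    by rewrite [RHS]mxE; exact: xu0.
  rewrite /dotrow big1; last by move=> j _; rewrite mxE mul0r.
  by rewrite subr_ge0; move: Gu; rewrite uE => Gu; exact: p_lb.
have [w wP] := upto m (leqnn m).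
by exists w => x u Fx Gu; apply: wP => // j; rewrite leqNgt ltn_ord.
Qed.

End Multiplier.

(** * Fixed points and minimizers *)

Section VecOfForms.
Context {R : realType} {X : hilbertType R} {m : nat}.
Variable A : 'I_m -> {linear X -> R}.

Let vec_of_forms_linear : linear (vec_of_forms A).
Proof.
by move=> a x y; apply/rowP => i; rewrite !mxE linearD linearZ.
Qed.

HB.instance Definition _ := GRing.isLinear.Build R X 'rV[R]_m *:%R
  (vec_of_forms A) vec_of_forms_linear.

End VecOfForms.

(** A cone over C that is a closed linear span contains the opposite of each
    point of C. *)
Lemma sri_sym {R : realType} {V : normedModType R} (C : set V) c :
  sri C 0 -> C c -> exists c' l, [/\ C c', 0 < l & c' = - l *: c].
Proof.
move=> [_ /= coneE] Cc.
have : closure (linear_span [set c - 0 | c in C]) (- c).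
  apply: subset_closure; exists 1%N, (fun=> -1), (fun=> c); split.
    by move=> _; exists c => //; rewrite subr0.
  by rewrite big_ord1 scaleN1r.
rewrite -coneE => -[l /= l0 [_ [c' Cc' <-]]]; rewrite subr0 => lc'.
exists c', l^-1; split; rewrite ?invr_gt0//.
by rewrite scaleNr -scalerN -lc' scalerA mulVf ?scale1r// gt_eqF.
Qed.

Section Blocks.
Context {R : realType} {X : hilbertType R} {m : nat}.
Variables (f : X -> \bar R) (g : 'I_m -> R -> \bar R) (A : 'I_m -> {linear X -> R}).
Hypotheses (f_Gamma0 : Gamma0 X f) (g_Gamma0 : forall i, Gamma0 R (g i)).
Hypotheses (A_bounded : forall i, bounded_near (A i) (nbhs (0 : X)))
  (A_neq0 : forall i, (A i : X -> R) <> cst 0).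

Definition block_fun (i : 'I_m.+1) : X -> \bar R :=
  if unlift ord_max i is Some j then g j \o A j else f.

Definition block_resolvent (i : 'I_m.+1) (y : X) : X :=
  if unlift ord_max i is Some j then y + (gram (A j))^-1 *:
    adjoint (A j) (prox (fun t => (gram (A j))%:E * g j t)%E (A j y) - A j y)
  else prox f y.

Lemma block_resolventP i : resolvent (block_fun i) (block_resolvent i).
Proof.
rewrite /block_fun /block_resolvent; case: unliftP => [j|] _.
  exact: comp_resolvent.
exact: prox_resolvent.
Qed.

(** The factor 2 in front of the inverse of gram (A j) comes from reflecting the
    resolvent of g j o A j. *)
Lemma T_DRSII_consensus : T_DRSII f g A = consensus_DR block_resolvent.
Proof.
apply/funext => x; apply/ffunP => i; rewrite !ffunE /block_resolvent /=.
case: unliftP => [j|] _ //=.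
set y := 2 *: average x - x i; set z := adjoint _ _.
by apply: inner_inj => h; rewrite !(innerDl, innerNl, innerZl); ring.
Qed.

Lemma sum_block_fun x :
  (\sum_i block_fun i x = f x + oplus g (vec_of_forms A x))%E.
Proof.
rewrite (bigD1_ord ord_max)//= {1}/block_fun unlift_none; congr (_ + _)%E.
by apply: eq_bigr => j _; rewrite /block_fun liftK mxE.
Qed.

Lemma subdiff_sum_argmin (k : nat) (h : 'I_k -> X -> \bar R) p (v : 'I_k -> X) :
  (forall i, subdiff (h i) p (v i)) -> \sum_i v i = 0 ->
  argmin (fun x => \sum_i h i x)%E setT p.
Proof.
move=> hv v0; split=> // y _.
have : (\sum_i (h i p + (inner (v i) (y - p))%:E) <= \sum_i h i y)%E.
  by apply: lee_sum => i _; case: (hv i).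
by rewrite big_split /= sumEFin -inner_suml v0 inner0l adde0.
Qed.

Let objective x := (f x + oplus g (vec_of_forms A x))%E.

Lemma average_Fix_argmin (x : hprod m.+1 X) :
  Fix (T_DRSII f g A) x -> argmin objective setT (average x).
Proof.
rewrite T_DRSII_consensus => /(Fix_consensus_DR block_resolventP) xP.
have -> : objective = (fun x => \sum_i block_fun i x)%E.
  by apply/funext => y; rewrite sum_block_fun.
apply: (subdiff_sum_argmin xP).
by rewrite sumrB averageP sumr_const card_ord -scaler_nat subrr.
Qed.

Hypothesis oplus_g_Gamma0 : Gamma0 'rV[R]_m (oplus g).
Hypothesis qualification :
  sri [set u - vec_of_forms A x | u in dom (oplus g) & x in dom f] 0.

Lemma oplus_dom u : dom (oplus g) u <-> forall i, dom (g i) (u ord0 i).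
Proof.
split=> [gu i|gu]; last by apply: lte_sum_pinfty => i _; exact: gu.
rewrite /dom /= ltey; apply/eqP => gi; move: gu; rewrite /dom /= /oplus.
rewrite (_ : \sum_(i < m) _ = +oo)%E ?ltxx//.
apply/esum_eqyP; first by move=> j _; case: (g_Gamma0 j) => -[].
by exists i; rewrite mem_index_enum.
Qed.

Lemma oplus_fine u : dom (oplus g) u ->
  fine (oplus g u) = \sum_i fine (g i (u ord0 i)).
Proof.
move=> /oplus_dom gu; rewrite sum_fine// => i _.
exact: Gamma0_dom_fin.
Qed.

(** With a multiplier w, the choice u = L p exhibits - A^* w as a subgradient of f,
    while x = p exhibits w as a subgradient of the separable function oplus g,
    whence w_j as a subgradient of g_j. *)
Lemma argmin_subdiff p : argmin objective setT p ->
  exists2 v : 'I_m.+1 -> X,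
    forall i, subdiff (block_fun i) p (v i) & \sum_i v i = 0.
Proof.
move=> [_ p_min].
pose L := vec_of_forms A.
have [fp gp] : dom f p /\ dom (oplus g) (L p).
  have [[u gu [x fx ux]] _] := qualification.
  have {ux} uE : u = L x by apply/eqP; rewrite -subr_eq0 ux.
  have : (objective p < +oo)%E.
    by apply: le_lt_trans (p_min x I) _; rewrite lte_add_pinfty// -/(L x) -uE.
  have f_Noo : f p != -oo%E by case: f_Gamma0 => -[].
  have g_Noo : oplus g (L p) != -oo%E by case: oplus_g_Gamma0 => -[].
  rewrite /objective /dom /= -/(L p).
  by case: (f p) (oplus g (L p)) f_Noo g_Noo => [a| |] [b| |]//; rewrite !ltry.
have p_le x : dom f x -> dom (oplus g) (L x) ->
    fine (f p) + fine (oplus g (L p)) <= fine (f x) + fine (oplus g (L x)).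
  move=> fx gx; have := p_min x I.
  rewrite /objective -(fineK (Gamma0_dom_fin f_Gamma0 fx)).
  rewrite -(fineK (Gamma0_dom_fin oplus_g_Gamma0 gx)).
  rewrite -(fineK (Gamma0_dom_fin f_Gamma0 fp)).
  by rewrite -(fineK (Gamma0_dom_fin oplus_g_Gamma0 gp)) -!EFinD lee_fin.
have sym x u : dom f x -> dom (oplus g) u -> exists x' u' l,
    [/\ dom f x', dom (oplus g) u', 0 < l & u' - L x' = - l *: (u - L x)].
  move=> fx gu; have [|_ [l [[u' gu' [x' fx' <-]] l0 E]]] :=
    sri_sym qualification (c := u - L x); first by exists u => //; exists x.
  by exists x', u', l.
have [w wP] := multiplier_exists (L := vec_of_forms A) f_Gamma0 oplus_g_Gamma0 p_le sym.
pose v (i : 'I_m.+1) := if unlift ord_max i is Some j then adjoint (A j) (w ord0 j)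
  else - \sum_j adjoint (A j) (w ord0 j).
exists v; last first.
  rewrite (bigD1_ord ord_max)//= {1}/v unlift_none addrC.
  by rewrite (eq_bigr (fun j => adjoint (A j) (w ord0 j))) ?subrr// => j _; rewrite /v liftK.
move=> i; rewrite /block_fun /v; case: unliftP => [j|] _.
  apply: subdiff_comp => //.
  have gj := (oplus_dom _).1 gp.
  have fgj k : g k (L p ord0 k) \is a fin_num by exact: Gamma0_dom_fin.
  have gAj : g j (A j p) \is a fin_num by have := fgj j; rewrite mxE.
  split=> // r.
  have [gr|] := pselect (dom (g j) r); last first.
    rewrite /dom/= => /negP; rewrite -leNgt leye_eq => /eqP ->; exact: leey.
  (* Moving only the jth coordinate of L p isolates the summand g j. *)
  pose u : 'rV[R]_m := \row_k (if k == j then r else L p ord0 k).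
  have gu : dom (oplus g) u.
    by apply/oplus_dom => k; rewrite mxE; case: eqP => [->|].
  have := wP p u fp gu; rewrite -/(L p) (oplus_fine gu) (oplus_fine gp).
  rewrite /dotrow (bigD1 j)//= big1 => [|k /negbTE kj]; last first.
    by rewrite !mxE kj ?mxE subrr mulr0.
  rewrite (bigD1 j)//= [in X in _ <= _ - X](bigD1 j)//=.
  rewrite (eq_bigr (fun k => fine (g k (L p ord0 k)))) => [|k /negbTE kj]; last first.
    by rewrite mxE kj.
  rewrite !mxE eqxx real_innerE -(fineK gAj).
  rewrite -(fineK (Gamma0_dom_fin (g_Gamma0 j) gr)) -EFinD lee_fin; lra.
split=> [|x]; first exact: Gamma0_dom_fin.
have [fx|] := pselect (dom f x); last first.
  rewrite /dom/= => /negP; rewrite -leNgt leye_eq => /eqP ->; exact: leey.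
have := wP x (L p) fx gp.
have -> : dotrow w (L p - L x) = inner (- \sum_j adjoint (A j) (w ord0 j)) (x - p).
  rewrite innerNl inner_suml -sumrN; apply: eq_bigr => j _.
  by rewrite adjointP// !mxE linearB; ring.
rewrite -(fineK (Gamma0_dom_fin f_Gamma0 fx)) -(fineK (Gamma0_dom_fin f_Gamma0 fp)).
rewrite -EFinD lee_fin; lra.
Qed.

Lemma average_Fix : @average R X m.+1 @` Fix (T_DRSII f g A) = argmin objective setT.
Proof.
apply/seteqP; split=> [_ [x xT <-]|p /argmin_subdiff[v vP v0]].
  exact: average_Fix_argmin.
have [x] := consensus_DR_Fix block_resolventP vP v0.
by rewrite -T_DRSII_consensus => xT xp; exists x.
Qed.

Lemma T_DRSII_nonexpansive : nonexpansive (T_DRSII f g A).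
Proof.
by rewrite T_DRSII_consensus; exact: consensus_DR_nonexpansive block_resolventP.
Qed.

End Blocks.

(** * Compactness in finite dimension *)

Section Frames.
Context {R : realType} {V : hilbertType R}.
Implicit Types (o s : seq V) (x y v e : V).

(** When this operator is the identity, o is a Parseval frame, for instance an
    orthonormal basis. *)
Definition frame_op o x : V := \sum_(e <- o) inner x e *: e.

Lemma frame_op_cons e o x : frame_op (e :: o) x = inner x e *: e + frame_op o x.
Proof. by rewrite /frame_op big_cons. Qed.

Lemma frame_opD o x y : frame_op o (x + y) = frame_op o x + frame_op o y.
Proof.
rewrite /frame_op -big_split; apply: eq_bigr => e _.
by rewrite innerDl scalerDl.
Qed.

Lemma frame_opZ o (a : R) x : frame_op o (a *: x) = a *: frame_op o x.
Proof.
rewrite /frame_op scaler_sumr; apply: eq_bigr => e _.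
by rewrite innerZl scalerA.
Qed.

Lemma frame_op_sym o x y : inner (frame_op o x) y = inner x (frame_op o y).
Proof.
rewrite [RHS]innerC !inner_suml; apply: eq_bigr => e _.
by rewrite !innerZl (innerC y) mulrC (innerC x).
Qed.

Lemma frame_op_orthogonal o x : (forall e, e \in o -> inner x e = 0) -> frame_op o x = 0.
Proof.
by move=> xo; rewrite /frame_op big_seq big1// => e /xo ->; rewrite scale0r.
Qed.

(** The Gram-Schmidt process.  The invariant is that the operator fixes both the
    given vectors and the vectors already produced; since it is self-adjoint, the
    remainder v - frame_op o v is orthogonal to the latter. *)
Lemma gram_schmidt s : exists o,
  (forall v, v \in s -> frame_op o v = v) /\ (forall e, e \in o -> frame_op o e = e).
Proof.
elim: s => [|v s [] o [os oo]]; first by exists [::].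
pose v' := v - frame_op o v.
have v'o e : e \in o -> inner v' e = 0.
  by move=> eo; rewrite innerBl frame_op_sym oo// subrr.
have [z|nz] := eqVneq v' 0.
  exists o; split => // u; rewrite inE => /orP[/eqP ->|]; last exact: os.
  by apply/esym/eqP; rewrite -subr_eq0 -/v' z.
have n0 : `|v'| != 0 by rewrite normr_eq0.
pose e' := `|v'|^-1 *: v'.
have e'o e : e \in o -> inner e' e = 0 by move=> /v'o h; rewrite innerZl h mulr0.
have Pe' : frame_op o e' = 0 by exact: frame_op_orthogonal.
have e'e' : inner e' e' = 1.
  by rewrite /e' innerZl innerZr inner_norm; field.
have old u : frame_op o u = u -> frame_op (e' :: o) u = u.
  move=> Pu; rewrite frame_op_cons Pu -[X in inner X _]Pu frame_op_sym Pe'.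
  by rewrite inner0r scale0r add0r.
exists (e' :: o); split => [u|e]; rewrite inE => /orP[/eqP ->|].
- have vE : v = frame_op o v + `|v'| *: e'.
    by rewrite /e' scalerA divff// scale1r /v' addrC subrK.
  have ve' : inner v e' = `|v'|.
    by rewrite [X in inner X _]vE innerDl frame_op_sym Pe' inner0r innerZl e'e' add0r mulr1.
  by rewrite frame_op_cons ve' addrC -vE.
- by move=> /os; exact: old.
- by rewrite frame_op_cons Pe' e'e' scale1r addr0.
- by move=> /oo; exact: old.
Qed.

Definition frame o := forall x, frame_op o x = x.

Lemma finite_dimensional_frame : finite_dimensional V -> exists o, frame o.
Proof.
move=> [n [e eV]]; have [b [be _]] := gram_schmidt [seq e i | i : 'I_n].
exists b => x; have : linear_span (range e) x by rewrite eV.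
move=> [k [c [u [ue ->]]]]; elim/big_rec: _ => [|i y _ yP].
  by rewrite -(scale0r 0) frame_opZ !scale0r.
rewrite frame_opD yP frame_opZ be//; have [j _ <-] := ue i.
by apply/mapP; exists j => //; rewrite mem_enum.
Qed.

(** The coefficients of a point of K on the frame lie in a compact box, so K is a
    closed subset of a continuous image of that box. *)
Lemma frame_compact o (K : set V) M :
  frame o -> closed K -> (forall x, K x -> `|x| <= M) -> compact K.
Proof.
move=> oV cK KM.
pose n := size o.
pose phi (c : 'rV[R]_n) : V := \sum_(i < n) c ord0 i *: tnth (in_tuple o) i.
have phi_cont : continuous phi.
  apply: continuous_big => [|i _ c]; first exact: add_continuous.
  exact: (cvgZr_tmp (@coord_continuous R 1 n ord0 i c)).
pose Q := [set c : 'rV[R]_n | forall i,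
  `[- (M * `|tnth (in_tuple o) i|), M * `|tnth (in_tuple o) i|]%classic (c ord0 i)].
have cQ : compact (phi @` Q).
  apply: continuous_compact; first exact: continuous_subspaceT.
  apply: (@rV_compact _ _ (fun i => `[- (M * `|tnth (in_tuple o) i|),
    M * `|tnth (in_tuple o) i|]%classic)) => i.
  exact: segment_compact.
apply: (subclosed_compact cK cQ) => x /KM xM.
exists (\row_i inner x (tnth (in_tuple o) i)); last first.
  rewrite -[RHS]oV /frame_op [RHS]big_tnth; apply: eq_bigr => i _.
  by rewrite mxE.
move=> i /=; rewrite mxE in_itv /=; set e := tnth _ i.
have xeM : `|x| * `|e| <= M * `|e| by rewrite ler_wpM2r.
have := inner_le_norm x e; have := inner_le_norm (- x) e.
rewrite innerNl normrN => h1 h2.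
by apply/andP; split; lra.
Qed.

End Frames.

Lemma hprod_frame {R : realType} {X : hilbertType R} (k : nat) (o : seq X) :
  frame o -> exists o' : seq (hprod k X), frame o'.
Proof.
move=> oX.
pose d (j : 'I_k) (e : X) : hprod k X := [ffun i => if i == j then e else 0].
exists [seq d j e | j <- enum 'I_k, e <- o] => x.
rewrite /frame_op big_allpairs_dep /= big_enum /=.
apply/ffunP => i; rewrite sum_ffunE (bigD1 i)//= sum_ffunE.
rewrite [X in _ + X]big1 ?addr0 => [|j /negbTE ji]; last first.
  rewrite sum_ffunE big1// => e _; rewrite !ffunE eq_sym ji scaler0; done.
rewrite -[RHS](oX (x i)); apply: eq_bigr => e _.
rewrite !ffunE eqxx; congr (_ *: _).
rewrite hprod_innerE (bigD1 i)//= ffunE eqxx big1 ?addr0// => j /negbTE ji.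
by rewrite ffunE ji inner0r.
Qed.

(** * Real sequences and distances *)

Section RealSequences.
Context {R : realType}.
Implicit Types (a b d lam : R^nat).

Lemma series_unbounded lam (M : R) (N : nat) : (forall n, 0 <= lam n) ->
  ~ cvgn (series lam) -> exists2 n, (N <= n)%N & M < series lam n.
Proof.
move=> lam0 lamoo; apply: contrapT => h; apply: lamoo.
have nd : nondecreasing_seq (series lam).
  by apply/nondecreasing_seqP => n; rewrite seriesSr lerDl.
apply: nondecreasing_is_cvgn => //; exists M => _ [n _ <-].
apply: le_trans (nd _ _ (leq_maxl n N)) _; rewrite leNgt; apply/negP => Mn.
by apply: h; exists (maxn n N) => //; exact: leq_maxr.
Qed.

(** The product of the factors 1 + b_n is at most the exponential of the sum of the
    b_n. *)
Lemma summable_growth_bounded a b (N : nat) :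
  (forall n, 0 <= a n) -> (forall n, 0 <= b n) -> cvgn (series b) ->
  (forall n, (N <= n)%N -> a n.+1 <= (1 + b n) * a n) ->
  exists M, forall n, (N <= n)%N -> a n <= M.
Proof.
move=> a0 b0 cb ab.
have nd : nondecreasing_seq (series b).
  by apply/nondecreasing_seqP => n; rewrite seriesSr lerDl.
have base : a N <= expR (series b N) * a N.
  by rewrite ler_peMl// -expR0 ler_expR seriesEnat /=; apply: sumr_ge0.
have anS n : (N <= n)%N -> a n <= expR (series b n) * a N.
  elim: n => [|n IH]; rewrite leq_eqVlt => /orP[/eqP <-|]//.
  rewrite ltnS => Nn; apply: le_trans (ab _ Nn) _.
  rewrite seriesSr expRD (mulrC (expR _)) -mulrA.
  by apply: ler_pM => //; [rewrite addr_ge0|exact: expR_ge1Dx|exact: IH].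
exists (expR (limn (series b)) * a N) => n Nn; apply: le_trans (anS n Nn) _.
by rewrite ler_wpM2r// ler_expR; exact: nondecreasing_cvgn_le.
Qed.

(** As long as d stays above e / 2 it loses at least r lam_n at each step, which
    cannot last since the steps are not summable; once below e / 2 it can only
    climb by C lam_n, which is eventually less than e / 2. *)
Lemma divergent_descent d lam (C : R) :
  (forall n, 0 <= d n) -> (forall n, 0 <= lam n) -> lam @ \oo --> 0 ->
  ~ cvgn (series lam) -> 0 <= C ->
  (\forall n \near \oo, d n.+1 <= d n + C * lam n) ->
  (forall e, 0 < e -> exists2 r, 0 < r &
    \forall n \near \oo, e <= d n -> d n.+1 <= d n - r * lam n) ->
  d @ \oo --> 0.
Proof.
move=> d0 lam0 lam_cvg lamoo C0 dC dr; apply/cvgrPdist_le => e e0.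
have e20 : 0 < e / 2 by rewrite divr_gt0.
have [r r0 rP] := dr _ e20.
have small : \forall n \near \oo, C * lam n <= e / 2.
  have : C * lam n @[n --> \oo] --> C * 0 by apply: cvgM => //; exact: cvg_cst.
  rewrite mulr0 => /cvgrPdist_le /(_ _ e20); apply: filterS => n.
  by rewrite sub0r normrN; apply: le_trans; exact: ler_norm.
have [N _ NP] : \forall n \near \oo, [/\ d n.+1 <= d n + C * lam n,
    C * lam n <= e / 2 & e / 2 <= d n -> d n.+1 <= d n - r * lam n].
  by near=> n; split; near: n.
have [n0 Nn0 dn0] : exists2 n0, (N <= n0)%N & d n0 < e / 2.
  apply: contrapT => h.
  have de n : (N <= n)%N -> e / 2 <= d n.
    by move=> Nn; rewrite leNgt; apply/negP => dn; apply: h; exists n.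
  have dS k : d (N + k)%N <= d N - r * (series lam (N + k)%N - series lam N).
    elim: k => [|k IH]; first by rewrite addn0 subrr mulr0 subr0.
    have Nk : (N <= N + k)%N by exact: leq_addr.
    have [_ _ /(_ (de _ Nk))] := NP _ Nk.
    rewrite addnS seriesSr; lra.
  have [n Nn] := series_unbounded (series lam N + d N / r) N lam0 lamoo.
  have := dS (n - N)%N; rewrite subnKC// => dn.
  rewrite -ltrBrDl ltr_pdivrMr// mulrC => h2.
  have := d0 n; lra.
exists n0 => // n /= n0n; rewrite sub0r normrN ger0_norm//.
rewrite -(subnKC n0n); elim: (n - n0)%N => [|k IH].
  by rewrite addn0; lra.
have [h1 h2 h3] := NP (n0 + k)%N (leq_trans Nn0 (leq_addr _ _)).
rewrite addnS; have [/h3 h|h] := leP (e / 2) (d (n0 + k)%N); last by lra.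
have := mulr_ge0 (ltW r0) (lam0 (n0 + k)%N); lra.
Unshelve. all: by end_near. Qed.

End RealSequences.

Section Distance.
Context {R : realType} {V : normedModType R}.
Implicit Types (S : set V) (x y : V).

Lemma dist_le S x y : S y -> dist S x <= `|x - y|.
Proof.
by move=> Sy; apply: ge_inf; [exists 0 => _ [z _ <-]|exists y].
Qed.

Lemma dist_ge S x r : S !=set0 -> (forall y, S y -> r <= `|x - y|) -> r <= dist S x.
Proof.
move=> [y Sy] h; apply: lb_le_inf; first by exists `|x - y|, y.
by move=> _ [z Sz <-]; exact: h.
Qed.

Lemma dist_ge0 S x : S !=set0 -> 0 <= dist S x.
Proof. by move=> S0; exact: dist_ge. Qed.

Lemma dist_sqr_le S x x' s : S !=set0 ->
  (forall y, S y -> `|x' - y| ^+ 2 <= `|x - y| ^+ 2 + s) ->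
  dist S x' ^+ 2 <= dist S x ^+ 2 + s.
Proof.
move=> S0 h; rewrite -lerBlDr.
have [le0|gt0] := leP (dist S x' ^+ 2 - s) 0.
  by apply: le_trans le0 _; exact: sqr_ge0.
rewrite -(sqr_sqrtr (ltW gt0)) ler_pXn2r ?nnegrE ?sqrtr_ge0 ?dist_ge0//.
apply: dist_ge => // y Sy.
rewrite -(@ler_pXn2r _ 2) ?nnegrE ?sqrtr_ge0// (sqr_sqrtr (ltW gt0)) lerBlDr.
apply: le_trans (h y Sy).
by rewrite ler_pXn2r ?nnegrE ?dist_ge0//; exact: dist_le.
Qed.

End Distance.

(** * Convergence of the hybrid steepest descent method *)

Section Continuity.
Context {R : realType} {V W : normedModType R}.

Lemma locally_lipschitz_continuous (F : V -> W) :
  (forall x, exists C, forall y, `|x - y| <= 1 -> `|F x - F y| <= C * `|x - y|) ->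
  continuous F.
Proof.
move=> FC x; have [C xC] := FC x.
apply/cvgrPdist_le => e e0.
have C0 : 0 < `|C| + 1 by rewrite ltr_wpDl.
near=> y.
have xy1 : `|x - y| <= 1.
  by near: y; apply: (cvgrPdist_le _ _).1; [exact: cvg_id|].
have xye : `|x - y| <= e / (`|C| + 1).
  by near: y; apply: (cvgrPdist_le _ _).1; [exact: cvg_id|rewrite divr_gt0].
apply: le_trans (xC y xy1) _.
apply: (@le_trans _ _ ((`|C| + 1) * `|x - y|)).
  rewrite ler_wpM2r//; have := ler_norm C; lra.
by rewrite mulrC -ler_pdivlMr.
Unshelve. all: by end_near. Qed.

Lemma closed_le_fun (F : V -> R) (a : R) : continuous F -> closed [set x | F x <= a].
Proof.
move=> Fc; apply: (preimage_closed (D := [set y | y <= a])) => [x _|]; first exact: Fc.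
exact: closed_le.
Qed.

Lemma closed_ge_fun (F : V -> R) (a : R) : continuous F -> closed [set x | a <= F x].
Proof.
move=> Fc; apply: (preimage_closed (D := [set y | a <= y])) => [x _|]; first exact: Fc.
exact: closed_ge.
Qed.

End Continuity.

Section HybridSteepestDescent.
Context {R : realType} {V : hilbertType R}.
Variables (o : seq V) (U : V -> V) (Theta : V -> R) (G : V -> V) (c K : R).
Hypothesis oV : frame o.
Hypothesis U_nexp : forall x y, `|U x - U y| <= `|x - y|.
Hypothesis c0 : 0 < c.
Hypothesis U_attracting : forall x p, Fix U p ->
  `|U x - p| ^+ 2 <= `|x - p| ^+ 2 - c * `|x - U x| ^+ 2.
Hypothesis Fix_bounded : bounded_set (Fix U).
Hypothesis Theta_grad : forall x y, Theta x + inner (G x) (y - x) <= Theta y.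
Hypothesis K0 : 0 <= K.
Hypothesis G_lip : forall x y, `|G x - G y| <= K * `|x - y|.

Let U_cont : continuous U.
Proof.
apply: locally_lipschitz_continuous => x; exists 1 => y _; rewrite mul1r.
exact: U_nexp.
Qed.

Let Theta_cont : continuous Theta.
Proof.
apply: locally_lipschitz_continuous => x; exists (`|G x| + K) => y xy1.
have h1 := Theta_grad x y; have h2 := Theta_grad y x.
have h3 := inner_le_norm (- G x) (y - x).
have h4 := inner_le_norm (G y) (y - x).
have Gy : `|G y| <= `|G x| + K.
  rewrite -[G y](subrK (G x)); apply: le_trans (ler_normD _ _) _.
  rewrite addrC lerD2l; apply: le_trans (G_lip _ _) _.
  by rewrite ler_piMr// distrC.
have h5 := ler_wpM2r (normr_ge0 (x - y)) Gy.
have h6 := mulr_ge0 K0 (normr_ge0 (x - y)).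
rewrite -(opprB y x) innerNr in h2.
rewrite innerNl normrN in h3.
rewrite (distrC y x) in h3 h4.
rewrite ler_norml; apply/andP; split; lra.
Qed.

Let displacement_cont : continuous (fun x => `|x - U x|).
Proof.
by move=> x; apply: cvg_norm; apply: cvgB; [exact: cvg_id|exact: U_cont].
Qed.

(** The attracting property after expansion of |U x - p|^2: the move from x to U x
    makes an acute angle with the direction of every fixed point. *)
Lemma displacement_angle x p : Fix U p ->
  (1 + c) / 2 * `|x - U x| ^+ 2 <= inner (x - U x) (x - p).
Proof.
move=> /(U_attracting x).
rewrite (_ : U x - p = (x - p) - (x - U x)); last by vector_field.
rewrite (normB_sqr (x - p)) (innerC (x - p)); lra.
Qed.

Lemma displacement_monotone x y : 0 <= inner ((x - U x) - (y - U y)) (x - y).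
Proof.
have -> : (x - U x) - (y - U y) = (x - y) - (U x - U y) by vector_field.
rewrite innerBl inner_norm subr_ge0.
apply: le_trans (inner_le_norm _ _) _.
by rewrite expr2 ler_wpM2r.
Qed.

(** Fixed points stay inside the ball of radius rho around p, so on the compact
    sphere the displacement has norm at least some d > 0, hence a radial component
    bounded below.  Beyond the sphere this radial component can only be larger,
    because I - U is monotone.  A linear gain, rather than one in the squared
    distance, is what makes it comparable to the drift of the gradient steps. *)
Lemma radial_decrease p : Fix U p -> exists rho e, [/\ 0 < rho, 0 < e &
  forall x, rho <= `|x - p| -> `|U x - p| <= `|x - p| - e].
Proof.
move=> Up; have [M M0 FM] := ex_strict_bound_gt0 Fix_bounded.
pose rho := M + `|p|.
have rho0 : 0 < rho by rewrite /rho ltr_wpDr.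
have Fix_rho q : Fix U q -> `|q - p| < rho.
  move=> /FM /= qM; apply: le_lt_trans (ler_normB _ _) _.
  by rewrite /rho ltrD2r.
pose S := [set x : V | `|x - p| <= rho] `&` [set x | rho <= `|x - p|].
have distp_cont : continuous (fun x : V => `|x - p|).
  by move=> x; apply: cvg_norm; apply: cvgB; [exact: cvg_id|exact: cvg_cst].
have [d d0 dP] : exists2 d, 0 < d & forall x, S x -> d <= `|x - U x|.
  have [S0|S0] := pselect (S !=set0); last first.
    by exists 1 => // x Sx; case: S0; exists x.
  have cS : compact S.
    apply: (frame_compact (M := rho + `|p|) oV).
      by apply: closedI; [exact: closed_le_fun|exact: closed_ge_fun].
    move=> x [/= xr _]; rewrite -[x](subrK p).
    by apply: le_trans (ler_normD _ _) _; rewrite lerD2r.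
  have [x Sx xP] := compact_EVT_min S0 cS (continuous_subspaceT displacement_cont).
  exists `|x - U x|; last by move=> y Sy; apply: xP; rewrite inE.
  rewrite normr_gt0 subr_eq0 eq_sym; apply/eqP => xU.
  move: Sx; rewrite inE => -[_ /=]; rewrite leNgt => /negP; apply.
  exact: Fix_rho.
pose e := (d ^+ 2 / 2 / rho) * (c / (1 + c)).
have c1 : 0 < 1 + c by rewrite addr_gt0.
have e0 : 0 < e by rewrite /e mulr_gt0 ?divr_gt0 ?exprn_gt0 ?ltr0n//.
exists rho, e; split => // x rx.
have r0 : 0 < `|x - p| by exact: lt_le_trans rx.
pose y := p + (rho / `|x - p|) *: (x - p).
have yp : y - p = (rho / `|x - p|) *: (x - p) by rewrite /y addrAC subrr add0r.
have ypr : `|y - p| = rho.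
  by rewrite yp normrZ ger0_norm ?divr_ge0 ?ltW// divfK// gt_eqF.
have Sy : S y by split; rewrite /= ypr.
have ang_y : d ^+ 2 / 2 <= inner (y - U y) (y - p).
  apply: le_trans (displacement_angle y Up).
  have := dP _ Sy; rewrite -(@ler_pXn2r _ 2) ?nnegrE ?(ltW d0)// => h.
  have := mulr_ge0 (ltW c0) (sqr_ge0 `|y - U y|); lra.
set k := rho / `|x - p| in yp.
have k0 : 0 < k by rewrite divr_gt0.
(* Monotonicity of I - U along the ray from p through x. *)
have ang_x : d ^+ 2 / 2 <= inner (x - U x) (y - p).
  apply: le_trans ang_y _.
  have : k <= 1 by rewrite ler_pdivrMr// mul1r.
  rewrite le_eqVlt => /orP[/eqP k1|k1].
    by rewrite (_ : y = x)// /y -/k k1 scale1r addrC subrK.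
  have := displacement_monotone x y.
  rewrite (_ : x - y = (1 - k) *: (x - p)); last first.
    by rewrite scalerBl scale1r -yp opprB addrA subrK.
  rewrite innerZr pmulr_rge0 ?subr_gt0// yp innerZr innerBl.
  move=> h; have := mulr_ge0 (ltW k0) h; rewrite innerZr; lra.
have ang_le := displacement_angle x Up.
have UxE : `|U x - p| ^+ 2 =
    `|x - p| ^+ 2 - 2 * inner (x - U x) (x - p) + `|x - U x| ^+ 2.
  rewrite (_ : U x - p = (x - p) - (x - U x)); last by vector_field.
  by rewrite (normB_sqr (x - p)) (innerC (x - p)).
move: ang_x; rewrite yp innerZr.
set s := inner _ _ in ang_le UxE *; set r := `|x - p| in r0 rx UxE k k0 yp ypr *.
set v := `|x - U x| ^+ 2 in ang_le UxE => ks.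
have sr : d ^+ 2 / 2 / rho * r <= s.
  rewrite mulrAC ler_pdivrMr//.
  have -> : s * rho = k * s * r by rewrite /k; field; rewrite gt_eqF.
  by rewrite ler_pM2r.
have ec : e * r <= s * (c / (1 + c)).
  by rewrite /e mulrAC ler_wpM2r// divr_ge0// ltW.
have vs : v <= s * (2 / (1 + c)).
  rewrite mulrA ler_pdivlMr//; lra.
have s2 : s * (2 / (1 + c)) = 2 * s - 2 * (s * (c / (1 + c))).
  by field; lra.
have sqr_le : `|U x - p| ^+ 2 <= r * (r - 2 * e) by rewrite UxE; lra.
have : 0 <= r * (r - 2 * e) by apply: le_trans sqr_le; exact: sqr_ge0.
rewrite pmulr_rge0// => re.
rewrite -(@ler_pXn2r _ 2) ?nnegrE//; last by lra.
apply: le_trans sqr_le _; have := sqr_ge0 e; lra.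
Qed.

Lemma Theta_grad_monotone x y : inner (G y) (x - y) <= inner (G x) (x - y).
Proof.
have := Theta_grad x y; have := Theta_grad y x.
by rewrite -(opprB x y) innerNr; lra.
Qed.

(** Monotonicity replaces G t by G p in the cross term, so the growth that is
    proportional to |t - p|^2 is of second order in the step l. *)
Lemma gradient_step_norm t p l : 0 <= l ->
  `|t - l *: G t - p| ^+ 2 <=
  (`|t - p| + 2 * l * `|G p|) ^+ 2 + 2 * K ^+ 2 * l ^+ 2 * `|t - p| ^+ 2.
Proof.
move=> l0; rewrite (_ : t - l *: G t - p = (t - p) - l *: G t); last first.
  by rewrite addrAC.
have h1 := Theta_grad_monotone t p.
have h2 := inner_le_norm (- G p) (t - p); rewrite innerNl normrN in h2.
have Gt : `|G t| <= `|G p| + K * `|t - p|.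
  rewrite -[G t](subrK (G p)) addrC; apply: le_trans (ler_normD _ _) _.
  by rewrite lerD2l.
rewrite (normB_sqr (t - p)) normZ_sqr innerZr (innerC (t - p)).
set D := `|t - p| in h2 Gt *; set C := `|G p| in h2 Gt *.
have D0 : 0 <= D by exact: normr_ge0.
have C0 : 0 <= C by exact: normr_ge0.
have Gt2 : `|G t| ^+ 2 <= 2 * C ^+ 2 + 2 * (K * D) ^+ 2.
  apply: (@le_trans _ _ ((C + K * D) ^+ 2)).
    by rewrite ler_pXn2r ?nnegrE ?addr_ge0 ?mulr_ge0.
  by have := sqr_ge0 (C - K * D); lra.
have h3 := ler_wpM2l (sqr_ge0 l) Gt2.
have h4 : l * - (C * D) <= l * inner (G t) (t - p) by rewrite ler_wpM2l//; lra.
have h5 := mulr_ge0 l0 (mulr_ge0 C0 D0).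
have h6 := mulr_ge0 (sqr_ge0 l) (sqr_ge0 C).
lra.
Qed.

Variables (lam : R^nat) (z : nat -> V).
Hypothesis lam0 : forall n, 0 <= lam n.
Hypothesis lam_sqr_summable : cvgn (series (fun n => lam n ^+ 2)).
Hypothesis lam_nonsummable : ~ cvgn (series lam).
Hypothesis zS : forall n, z n.+1 = U (z n) - lam n *: G (U (z n)).

Let lam_small e : 0 < e -> \forall n \near \oo, lam n <= e.
Proof.
move=> e0; have /cvgrPdist_le := cvg_series_cvg_0 lam_sqr_summable.
have e20 : 0 < e ^+ 2 by rewrite exprn_gt0.
move=> /(_ _ e20); apply: filterS => n.
rewrite sub0r normrN ger0_norm ?sqr_ge0// ler_pXn2r ?nnegrE//.
exact: ltW.
Qed.

Let lam_small_mul C e : 0 < e -> \forall n \near \oo, lam n * C <= e.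
Proof.
move=> e0; have C0 : 0 < `|C| + 1 by rewrite ltr_wpDl.
have : 0 < e / (`|C| + 1) by rewrite divr_gt0.
move=> /lam_small; apply: filterS => n; rewrite ler_pdivlMr//.
apply: le_trans; rewrite ler_wpM2l//; have := ler_norm C; lra.
Qed.

(** Once the steps are small enough, the maximum of |z_n - p|^2 and (rho + e)^2
    grows by a factor of at most 1 + 2 K^2 lam_n^2: outside the ball the radial
    decrease absorbs the drift 2 lam_n |G p|, and inside it the new point stays
    within rho + e up to this factor. *)
Lemma trajectory_bounded p : Fix U p ->
  exists M, \forall n \near \oo, `|z n - p| <= M.
Proof.
move=> Up; have [rho [e [rho0 e0 dec]]] := radial_decrease Up.
pose a n := Num.max (`|z n - p| ^+ 2) ((rho + e) ^+ 2).
pose b n := 2 * K ^+ 2 * lam n ^+ 2.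
have b0 n : 0 <= b n by rewrite /b !mulr_ge0// sqr_ge0.
have a0 n : 0 <= a n by rewrite /a le_max sqr_ge0.
have cb : cvgn (series b) by exact: is_cvg_seriesZ.
have [N _ NP] := lam_small_mul (2 * `|G p|) e0.
have aS n : (N <= n)%N -> a n.+1 <= (1 + b n) * a n.
  move=> /NP /= le_e.
  have za : `|z n - p| ^+ 2 <= a n by rewrite /a le_max lexx.
  have ra : (rho + e) ^+ 2 <= a n by rewrite /a le_max lexx orbT.
  rewrite {1}/a ge_max; apply/andP; split; last first.
    apply: le_trans ra _; rewrite ler_peMl//; have := b0 n; lra.
  rewrite zS; apply: le_trans (gradient_step_norm _ _ (lam0 n)) _.
  rewrite -/(b n) [leRHS]mulrDl mul1r.
  have Dz : `|U (z n) - p| <= `|z n - p| by rewrite -{1}Up.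
  have D0 := normr_ge0 (U (z n) - p).
  have z0 := normr_ge0 (z n - p).
  have Da : `|U (z n) - p| ^+ 2 <= a n.
    by apply: le_trans za; rewrite ler_pXn2r ?nnegrE.
  apply: lerD; last by rewrite ler_wpM2l.
  have l0 : 0 <= 2 * lam n * `|G p| by rewrite !mulr_ge0.
  have [rz|zr] := leP rho `|z n - p|.
    apply: le_trans za; rewrite ler_pXn2r ?nnegrE ?addr_ge0//.
    have := dec _ rz; lra.
  apply: le_trans ra; rewrite ler_pXn2r ?nnegrE ?addr_ge0//; lra.
have [M MP] := summable_growth_bounded a0 b0 cb aS.
exists (Num.sqrt M); exists N => // n /= /MP aM.
rewrite -[leLHS]ger0_norm// -sqrtr_sqr ler_wsqrtr//.
by apply: le_trans aM; rewrite /a le_max lexx.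
Qed.

Let Gamma := argmin (EFin \o Theta) (Fix U).

(** The attracting property bounds |U z_n - p|, and convexity bounds the cross
    term of the gradient step by the excess of Theta over Theta p. *)
Lemma trajectory_descent p n (t := U (z n)) : Fix U p ->
  `|z n.+1 - p| ^+ 2 <= `|z n - p| ^+ 2 - c * `|z n - t| ^+ 2
    - 2 * lam n * (Theta t - Theta p) + lam n ^+ 2 * `|G t| ^+ 2.
Proof.
move=> Up; rewrite zS -/t.
rewrite (_ : t - lam n *: G t - p = (t - p) - lam n *: G t); last by rewrite addrAC.
rewrite (normB_sqr (t - p)) normZ_sqr innerZr.
have h1 := U_attracting (z n) Up; rewrite -/t in h1.
have := Theta_grad t p; rewrite -(opprB t p) innerNr innerC => h2.
have h3 : lam n * (Theta t - Theta p) <= lam n * inner (t - p) (G t).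
  by rewrite ler_wpM2l//; lra.
lra.
Qed.

(** The squared distance to Gamma satisfies the hypotheses of divergent_descent.
    The bound on its growth comes from the boundedness of the trajectory.
    For the descent, the larger of c |x - U x|^2 and Theta (U x) - Theta p0 is
    positive away from Gamma, since a point x where it is at most 0 is a fixed point
    that minimizes Theta; hence it has a positive minimum on the compact set of
    bounded points at distance at least sqrt e from Gamma. *)
Theorem hybrid_steepest_descent : Gamma !=set0 -> dist Gamma (z n) @[n --> \oo] --> 0.
Proof.
move=> [p0 [Up0 p0_min]].
have Gamma0 : Gamma !=set0 by exists p0; split.
have Gamma_Theta p : Gamma p -> Theta p = Theta p0.
  move=> [Up p_min]; apply/eqP; rewrite eq_le -!lee_fin.
  by apply/andP; split; [exact: p_min|exact: p0_min].
have [M zM] := trajectory_bounded Up0.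
have M0 : 0 <= M by have [n] := filter_ex zM; exact: le_trans.
pose B := `|G p0| + K * M.
have B0 : 0 <= B by rewrite addr_ge0 ?mulr_ge0.
have UzM n : `|z n - p0| <= M -> `|U (z n) - p0| <= M.
  by apply: le_trans; rewrite -{1}Up0.
have GB n : `|z n - p0| <= M -> `|G (U (z n))| <= B.
  move=> /UzM UM; rewrite -[G _](subrK (G p0)) addrC.
  apply: le_trans (ler_normD _ _) _; rewrite lerD2l.
  by apply: le_trans (G_lip _ _) _; rewrite ler_wpM2l.
have Theta_lb n : `|z n - p0| <= M -> Theta p0 - Theta (U (z n)) <= `|G p0| * M.
  move=> /UzM UM; have := Theta_grad p0 (U (z n)).
  have := inner_le_norm (- G p0) (U (z n) - p0); rewrite innerNl normrN.
  have := ler_wpM2l (normr_ge0 (G p0)) UM; lra.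
pose C := 2 * (`|G p0| * M) + B ^+ 2.
have C0 : 0 <= C by rewrite addr_ge0 ?sqr_ge0// !mulr_ge0.
have step n : `|z n - p0| <= M ->
    dist Gamma (z n.+1) ^+ 2 <= dist Gamma (z n) ^+ 2 +
      (- (c * `|z n - U (z n)| ^+ 2) - 2 * lam n * (Theta (U (z n)) - Theta p0)
       + lam n ^+ 2 * B ^+ 2).
  move=> zn; apply: dist_sqr_le => // p Gp.
  have := trajectory_descent n (proj1 Gp); rewrite (Gamma_Theta _ Gp).
  have : lam n ^+ 2 * `|G (U (z n))| ^+ 2 <= lam n ^+ 2 * B ^+ 2.
    by rewrite ler_wpM2l ?sqr_ge0// ler_pXn2r ?nnegrE// GB.
  lra.
have lam1 : \forall n \near \oo, lam n <= 1 by exact: lam_small.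
have stepC n : `|z n - p0| <= M -> lam n <= 1 ->
    - (2 * lam n * (Theta (U (z n)) - Theta p0)) + lam n ^+ 2 * B ^+ 2 <= C * lam n.
  move=> zn ln1; have := ler_wpM2l (lam0 n) (Theta_lb _ zn).
  have : lam n ^+ 2 * B ^+ 2 <= lam n * B ^+ 2.
    by rewrite ler_wpM2r ?sqr_ge0// expr2 ler_piMr.
  rewrite /C; lra.
suff d2 : dist Gamma (z n) ^+ 2 @[n --> \oo] --> 0.
  apply/cvgrPdist_le => e e0; have e20 : 0 < e ^+ 2 by rewrite exprn_gt0.
  move/cvgrPdist_le : d2 => /(_ _ e20); apply: filterS => n.
  have dn0 := dist_ge0 (z n) Gamma0.
  rewrite ![`|0 - _|]distrC !subr0 (ger0_norm dn0) ger0_norm ?sqr_ge0//.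
  by rewrite ler_pXn2r ?nnegrE// ltW.
apply: (@divergent_descent _ (fun n => dist Gamma (z n) ^+ 2) lam C) => //.
- by move=> n; exact: sqr_ge0.
- apply/cvgrPdist_le => e e0; have := lam_small e0; apply: filterS => n.
  by rewrite sub0r normrN ger0_norm.
- near=> n.
  have zn : `|z n - p0| <= M by near: n.
  have ln1 : lam n <= 1 by near: n.
  have := step _ zn; have := stepC _ zn ln1.
  have := mulr_ge0 (ltW c0) (sqr_ge0 `|z n - U (z n)|); lra.
move=> e e0.
pose S := [set x : V | `|x - p0| <= M] `&`
  \bigcap_(p in Gamma) [set x : V | Num.sqrt e <= `|x - p|].
have dist_cont (p : V) : continuous (fun x : V => `|x - p|).
  by move=> x; apply: cvg_norm; apply: cvgB; [exact: cvg_id|exact: cvg_cst].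
have cS : compact S.
  apply: (frame_compact (M := M + `|p0|) oV).
    apply: closedI; first exact: closed_le_fun.
    by apply: closed_bigI => p _; exact: closed_ge_fun.
  move=> x [/= xM _]; rewrite -[x](subrK p0).
  by apply: le_trans (ler_normD _ _) _; rewrite lerD2r.
have zS_far n : `|z n - p0| <= M -> e <= dist Gamma (z n) ^+ 2 -> S (z n).
  move=> zn en; split => // p Gp /=.
  apply: le_trans (dist_le (z n) Gp).
  rewrite -[leRHS]ger0_norm ?dist_ge0// -sqrtr_sqr.
  exact: ler_wsqrtr.
pose phi x := Num.max (c * `|x - U x| ^+ 2) (Theta (U x) - Theta p0).
have phi_cont : continuous phi.
  move=> x; apply: (@continuous_max _ _ (fun x => c * `|x - U x| ^+ 2)
    (fun x => Theta (U x) - Theta p0)).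
    apply: cvgM; first exact: cvg_cst.
    by rewrite expr2; apply: cvgM; exact: displacement_cont.
  apply: cvgB; last exact: cvg_cst.
  by apply: continuous_comp; [exact: U_cont|exact: Theta_cont].
(* Either the displacement or the excess of Theta is bounded away from zero on
   the bounded part of the space that stays away from Gamma. *)
have [mu mu0 muP] : exists2 mu, 0 < mu & forall x, S x -> mu <= phi x.
  have [S0|S0] := pselect (S !=set0); last first.
    by exists 1 => // x Sx; case: S0; exists x.
  have [x Sx xP] := compact_EVT_min S0 cS (continuous_subspaceT phi_cont).
  exists (phi x); last by move=> y Sy; apply: xP; rewrite inE.
  rewrite ltNge; apply/negP; rewrite /phi ge_max => /andP[Ux Tx].
  have Fx : Fix U x.
    apply/eqP; rewrite eq_sym -subr_eq0 -normr_eq0 -sqrf_eq0 eq_le sqr_ge0 andbT.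
    by move: Ux; rewrite pmulr_rle0.
  have Gx : Gamma x.
    split => // y Uy /=; apply: le_trans (p0_min y Uy); rewrite lee_fin.
    by move: Tx; rewrite Fx subr_le0.
  move: Sx; rewrite inE => -[_ /(_ _ Gx)] /=.
  by rewrite subrr normr0 leNgt sqrtr_gt0 e0.
exists (Num.min 1 mu); first by rewrite lt_min ltr01.
near=> n => en.
have zn : `|z n - p0| <= M by near: n.
have ln1 : lam n <= 1 by near: n.
have ln2 : lam n * (1 + C) <= mu by near: n; exact: lam_small_mul.
have ln3 : lam n * B ^+ 2 <= mu by near: n; exact: lam_small_mul.
have := muP _ (zS_far _ zn en); rewrite /phi le_max.
have := step _ zn; have := stepC _ zn ln1; have l0 := lam0 n.
have m1 : Num.min 1 mu * lam n <= lam n by rewrite ler_piMl// ge_min lexx.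
have m2 : Num.min 1 mu * lam n <= mu * lam n by rewrite ler_wpM2r// ge_min lexx orbT.
move=> h1 h2 /orP[h3|h3]; first by lra.
have h4 := ler_wpM2l l0 h3.
have h5 := ler_wpM2l l0 ln3.
have h6 := mulr_ge0 (ltW c0) (sqr_ge0 `|z n - U (z n)|).
lra.
Unshelve. all: by end_near. Qed.

End HybridSteepestDescent.

(** * Descent through the average *)

Section Gradient.
Context {R : realType} {X : hilbertType R}.
Implicit Types (F : X -> R) (x y v : X).

Lemma gradP F x : gateaux_differentiable F -> is_gradient F x (grad F x).
Proof. by move=> dF; apply: (xgetPex 0 (dF x)). Qed.

Lemma grad_unique F x v : is_gradient F x v -> grad F x = v.
Proof.
move=> Fv; have /= Fg : is_gradient F x (grad F x) by apply: xgetPex; exists v.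
apply: inner_inj => h.
have dv := Fv h; have dg := Fg h.
by rewrite -(@derive_val _ _ _ _ _ _ _ dv) -(@derive_val _ _ _ _ _ _ _ dg).
Qed.

(** The difference quotients along the segment from x to y are at most F y - F x by
    convexity. *)
Lemma convex_gradient_ineq F x y v : convex_efun (EFin \o F) ->
  is_gradient F x v -> F x + inner v (y - x) <= F y.
Proof.
move=> cF /(_ (y - x)) [dF dFE].
suff : inner v (y - x) <= F y - F x by lra.
rewrite -dFE; apply: (@closed_cvg _ _ (0 : R)^'+ _ (fun t : R =>
  t^-1 *: (F (t *: (y - x) + x) - F x)) [set r | r <= F y - F x]).
- exact: closed_le.
- near=> t.
  have t0 : 0 < t by near: t; exact: nbhs_right_gt.
  have t1 : t < 1 by near: t; exact: nbhs_right_lt.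
  have := cF y x t; rewrite t0 t1 => /(_ isT).
  rewrite /= -!EFinM -EFinD lee_fin.
  rewrite (_ : t *: y + (1 - t) *: x = t *: (y - x) + x); last by vector_field.
  rewrite /GRing.scale /= ler_pdivrMl//; lra.
- by apply: cvg_dnbhs_at_right; exact: dF.
Unshelve. all: by end_near. Qed.

End Gradient.

Section AverageGradient.
Context {R : realType} {X : hilbertType R} (k : nat) (Psi : X -> R).
Local Notation H := (hprod k.+1 X).
Local Notation avg := (@average R X k.+1).

Lemma convex_average : convex_efun (EFin \o Psi) -> convex_efun (EFin \o (Psi \o avg)).
Proof.
move=> cP x y t t01; have := cP (avg x) (avg y) t t01.
by rewrite /= averageD !averageZ.
Qed.

(** The difference quotients of Psi o average are those of Psi in the averaged
    direction, and h |-> <v, average h> is represented by the constant family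
    v / (k + 1). *)
Lemma is_gradient_average (z : H) v : is_gradient Psi (avg z) v ->
  is_gradient (Psi \o avg) z ([ffun=> k.+1%:R^-1 *: v] : H).
Proof.
move=> Pv h.
have -> : inner ([ffun=> k.+1%:R^-1 *: v] : H) h = inner v (avg h).
  rewrite hprod_innerE /average innerZr innerC inner_suml mulr_sumr.
  by apply: eq_bigr => i _; rewrite ffunE innerZl (innerC v).
have quotE : (fun t : R => t^-1 *: (((Psi \o avg) \o shift z) (t *: h) - (Psi \o avg) z)) =
    (fun t : R => t^-1 *: ((Psi \o shift (avg z)) (t *: avg h) - Psi (avg z))).
  by apply/funext => t /=; rewrite averageD averageZ.
have [dP dPE] := Pv (avg h).
split; first by rewrite /derivable quotE.
by rewrite -dPE /derive quotE.
Qed.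

Hypothesis Psi_gateaux : gateaux_differentiable Psi.

Lemma gateaux_average : gateaux_differentiable (Psi \o avg).
Proof.
move=> z; exists [ffun=> k.+1%:R^-1 *: grad Psi (avg z)].
exact/is_gradient_average/gradP.
Qed.

Lemma grad_average (z : H) :
  grad (Psi \o avg) z = [ffun=> k.+1%:R^-1 *: grad Psi (avg z)].
Proof. exact/grad_unique/is_gradient_average/gradP. Qed.

Lemma grad_average_lipschitz K : 0 <= K ->
  (forall x y, `|grad Psi x - grad Psi y| <= K * `|x - y|) ->
  forall z z' : H, `|grad (Psi \o avg) z - grad (Psi \o avg) z'| <= K * `|z - z'|.
Proof.
move=> K0 PK z z'; set d := grad Psi (avg z) - grad Psi (avg z').
apply: (@le_trans _ _ `|d|); last first.
  apply: le_trans (PK _ _) _; rewrite -averageB ler_wpM2l//.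
  exact: average_norm.
rewrite normr_le_sqr hprod_norm_sqrE.
rewrite (eq_bigr (fun=> k.+1%:R^-1 ^+ 2 * `|d| ^+ 2)); last first.
  by move=> i _; rewrite !grad_average !ffunE -scalerBr normZ_sqr.
rewrite sumr_const card_ord -(mulr_natl (_ * _)) mulrA ler_piMl ?sqr_ge0//.
by rewrite expr2 mulrA divff ?pnatr_eq0// mul1r invf_le1 ?ltr0n// ler1n.
Qed.

End AverageGradient.

Section Relaxation.
Context {R : realType} {V : hilbertType R} (T : V -> V) (alpha : R).
Hypothesis T_nexp : nonexpansive T.
Hypothesis alpha01 : 0 < alpha < 1.

Definition relaxation z := (1 - alpha) *: z + alpha *: T z.

Let a0 : 0 < alpha. Proof. by case/andP: alpha01. Qed.
Let a1 : 0 < 1 - alpha. Proof. by case/andP: alpha01 => _; rewrite subr_gt0. Qed.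

Lemma Fix_relaxation : Fix relaxation = Fix T.
Proof.
apply/seteqP; split=> z /=; rewrite /Fix /relaxation /= => zT; last first.
  by rewrite zT; vector_field.
have : alpha *: (T z - z) = 0.
  by rewrite -[RHS](subrr z) -{3}zT; vector_field.
move/eqP; rewrite scaler_eq0 gt_eqF//= subr_eq0 => /eqP.
by [].
Qed.

(** This identity is where relaxation gains over nonexpansiveness: the last term is
    what the attracting property keeps. *)
Lemma norm_convex_comb (x y : V) :
  `|(1 - alpha) *: x + alpha *: y| ^+ 2 = (1 - alpha) * `|x| ^+ 2 +
    alpha * `|y| ^+ 2 - alpha * (1 - alpha) * `|x - y| ^+ 2.
Proof. by rewrite (normB_sqr x) normD_sqr !normZ_sqr innerZl innerZr; ring. Qed.

Lemma relaxation_nonexpansive : nonexpansive relaxation.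
Proof.
apply/nonexpansiveP => x y.
rewrite (_ : relaxation x - relaxation y =
    (1 - alpha) *: (x - y) + alpha *: (T x - T y)); last first.
  by rewrite /relaxation; vector_field.
apply: le_trans (ler_normD _ _) _; rewrite !normrZ !gtr0_norm//.
have := (nonexpansiveP T).1 T_nexp x y; rewrite -(ler_pM2l a0); lra.
Qed.

Lemma relaxation_attracting x p : Fix relaxation p ->
  `|relaxation x - p| ^+ 2 <= `|x - p| ^+ 2 -
    (1 - alpha) / alpha * `|x - relaxation x| ^+ 2.
Proof.
rewrite Fix_relaxation => Tp.
rewrite (_ : relaxation x - p = (1 - alpha) *: (x - p) + alpha *: (T x - p)); last first.
  by rewrite /relaxation; vector_field.
rewrite norm_convex_comb.
rewrite (_ : x - relaxation x = alpha *: (x - T x)); last first.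
  by rewrite /relaxation; vector_field.
rewrite (_ : x - p - (T x - p) = x - T x); last by vector_field.
rewrite normZ_sqr.
have -> : (1 - alpha) / alpha * (alpha ^+ 2 * `|x - T x| ^+ 2) =
    alpha * (1 - alpha) * `|x - T x| ^+ 2 by field; rewrite gt_eqF.
have : `|T x - p| ^+ 2 <= `|x - p| ^+ 2.
  by rewrite -normr_le_sqr -{1}Tp; exact: (nonexpansiveP T).1.
rewrite -(ler_pM2l a0); lra.
Qed.

End Relaxation.

Theorem theorem17 (R : realType) (X : hilbertType R) (m : nat) (m_gt0 : (0 < m)%N)
  (f : X -> \bar R) (g : 'I_m -> R -> \bar R) (A : 'I_m -> {linear X -> R})
  (Psi : X -> R)
  (f_Gamma0 : f \in Gamma0 X)
  (g_Gamma0 : forall i, g i \in Gamma0 R)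
  (oplus_g_Gamma0 : oplus g \in Gamma0 'rV[R]_m)
  (A_bounded : forall i, bounded_near (A i) (nbhs (0 : X)))
  (A_neq0 : forall i, (A i : X -> R) <> cst 0)
  (S_p := argmin (fun x => f x + oplus g (vec_of_forms A x))%E setT)
  (S_p_nonempty : S_p !=set0)
  (qualification :
     0 \in sri [set u - vec_of_forms A x | u in dom (oplus g) & x in dom f])
  (Psi_Gamma0 : EFin \o Psi \in Gamma0 X)
  (Psi_gateaux : gateaux_differentiable Psi)
  (grad_Psi_lipschitz : exists k : R, k.-lipschitz (grad Psi))
  (Omega := argmin (EFin \o Psi) S_p)
  (Omega_nonempty : Omega !=set0)
  (T := T_DRSII f g A)
  (Theta := Psi \o @average R X m.+1) :
  nonexpansive T /\
  forall (alpha : R) (lam : R^nat), 0 < alpha < 1 ->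
    (fun n => lam n.+1) \in ell2_plus `\` ell1_plus ->
    let T_alpha := fun z => (1 - alpha) *: z + alpha *: T z in
    hsdm_applicable T_alpha Theta /\
    (* xhalf n is the vector of the x_{n+1/2}^(i) *)
    forall (x0 : hprod m.+1 X) (x xhalf : nat -> hprod m.+1 X) (xstar : nat -> X),
      x 0%N = x0 ->
      (forall n, xhalf n = (1 - alpha) *: x n + alpha *: T (x n)) ->
      (forall n, xstar n.+1 = m.+1%:R^-1 *: \sum_(j < m.+1) xhalf n j) ->
      (forall n i,
         x n.+1 i = xhalf n i - (lam n.+1 / m.+1%:R) *: grad Psi (xstar n.+1)) ->
      (forall n, x n.+1 = hsdm_step T_alpha Theta (lam n.+1) (x n)) /\
      (finite_dimensional X -> bounded_set (Fix T) ->
         dist Omega (xstar n) @[n --> \oo] --> 0).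

Proof.
have f0 : Gamma0 X f by rewrite inE in f_Gamma0.
have g0 i : Gamma0 R (g i) by have := g_Gamma0 i; rewrite inE.
have og0 : Gamma0 'rV[R]_m (oplus g) by rewrite inE in oplus_g_Gamma0.
have qual : sri [set u - vec_of_forms A x | u in dom (oplus g) & x in dom f] 0.
  by rewrite inE in qualification.
have Psi0 : Gamma0 X (EFin \o Psi) by rewrite inE in Psi_Gamma0.
have Psi_convex : convex_efun (EFin \o Psi) by case: Psi0.
have T_nexp : nonexpansive T by exact: T_DRSII_nonexpansive.
have avgT : @average R X m.+1 @` Fix T = S_p by exact: average_Fix.
split=> // alpha lam alpha01; rewrite inE => -[[lam0 lam2] lam1] T_alpha.
split.
  split; first exact: relaxation_nonexpansive.
    exact: convex_average.
  exact: gateaux_average.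
move=> x0 x xhalf xstar _ xhalfE xstarE xE.
have xstarE' n : xstar n.+1 = average (T_alpha (x n)) by rewrite xstarE xhalfE.
have xS n : x n.+1 = hsdm_step T_alpha Theta (lam n.+1) (x n).
  apply/ffunP => i; rewrite xE xhalfE xstarE' /hsdm_step -/(T_alpha (x n)).
  move: (T_alpha (x n)) => t.
  by rewrite grad_average// !ffunE scalerA.
split=> // fdX Fix_bounded.
have [b bX] := finite_dimensional_frame fdX.
have [b' bH] := hprod_frame m.+1 bX.
have [k kP] := grad_Psi_lipschitz.
have PsiK u v : `|grad Psi u - grad Psi v| <= `|k| * `|u - v|.
  apply: le_trans (kP (u, v) (conj I I)) _ => /=.
  by rewrite ler_wpM2r// ler_norm.
pose Gamma := argmin (EFin \o Theta) (Fix T_alpha).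
have FixE : Fix T_alpha = Fix T by exact: Fix_relaxation.
have Gamma_Omega p : Gamma p -> Omega (average p).
  move=> [+ p_min]; rewrite FixE => Tp; split; first by rewrite -avgT; exists p.
  move=> y; rewrite -avgT => -[q Tq <-]; apply: p_min.
  by rewrite FixE.
have Gamma_nonempty : Gamma !=set0.
  have [w [+ w_min]] := Omega_nonempty.
  rewrite -avgT => -[q Tq qw]; exists q; split; first by rewrite FixE.
  move=> y; rewrite FixE => Ty; rewrite /Theta /= qw; apply: w_min.
  by rewrite -avgT; exists y.
have T_alpha_nexp u v : `|T_alpha u - T_alpha v| <= `|u - v|.
  by apply: (nonexpansiveP T_alpha).1; exact: relaxation_nonexpansive.
have x_Gamma : dist Gamma (x n) @[n --> \oo] --> 0.
  have c0 : 0 < (1 - alpha) / alpha.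
    by case/andP: alpha01 => a0 a1; rewrite divr_gt0// subr_gt0.
  have attracting u p : Fix T_alpha p -> `|T_alpha u - p| ^+ 2 <=
      `|u - p| ^+ 2 - (1 - alpha) / alpha * `|u - T_alpha u| ^+ 2.
    exact: relaxation_attracting.
  have Fixb : bounded_set (Fix T_alpha) by rewrite FixE.
  have Theta_grad u v : Theta u + inner (grad Theta u) (v - u) <= Theta v.
    apply: convex_gradient_ineq; first exact: convex_average.
    exact/gradP/gateaux_average.
  have Theta_lip := grad_average_lipschitz (k := m) Psi_gateaux (normr_ge0 k) PsiK.
  have lam_div : ~ cvgn (series (fun n => lam n.+1)).
    by move=> cl; apply: lam1; split.
  exact: (hybrid_steepest_descent bH T_alpha_nexp c0 attracting Fixb Theta_grad
    (normr_ge0 k) Theta_lip lam0 lam2 lam_div xS Gamma_nonempty).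
have Omega_le n : dist Omega (xstar n.+1) <= dist Gamma (x n).
  apply: dist_ge => // p Gp.
  apply: le_trans (dist_le (xstar n.+1) (Gamma_Omega _ Gp)) _.
  rewrite xstarE' -averageB; apply: le_trans (average_norm _) _.
  by rewrite -{1}(proj1 Gp).
rewrite -cvg_shiftS; apply: (squeeze_cvgr _ (cvg_cst 0) x_Gamma).
by apply: nearW => n; rewrite dist_ge0//=.
Qed.
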